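(* Let $A_\Gamma$ be an Artin group satisfying property (Int): for each free of infinity subset $Y\subset V(\Gamma)$ and for all parabolic subgroups $P_1,P_2$ of $A_Y$, the intersection $P_1\cap P_2$ is a parabolic subgroup of $A_Y$. Then $A_\Gamma$ satisfies property (Int+--): for each complete parabolic subgroup $P_1$ of $A_\Gamma$ and for each parabolic subgroup $P_2$ of $A_\Gamma$, the intersection $P_1\cap P_2$ is a parabolic subgroup of $A_\Gamma$.
   Context: Let $\Gamma$ be a finite non-empty simplicial graph with vertex set $V(\Gamma)$, edge set $E(\Gamma)$ and an edge-labeling $m\colon E(\Gamma)\to\{2,3,4,\ldots\}$. The Artin group $A_\Gamma$ is the group with generating set $V(\Gamma)$ and relations $vwv\cdots = wvw\cdots$ (both sides alternating words with $m(\{v,w\})$ letters) for each $\{v,w\}\in E(\Gamma)$. For $X\subset V(\Gamma)$, $A_X$ denotes the subgroup of $A_\Gamma$ generated by $X$ (trivial if $X=\emptyset$); by a theorem of van der Lek it is canonically isomorphic to the Artin group $A_{\langle X\rangle}$ of the induced labeled subgraph $\langle X\rangle$. Subgroups of the form $A_X$ are called standard parabolic; a parabolic subgroup of $A_\Gamma$ is a conjugate $gA_Xg^{-1}$ with $g\in A_\Gamma$, $X\subset V(\Gamma)$. Parabolic subgroups of $A_Y$ ($Y\subset V(\Gamma)$) are those of the Artin group $A_Y=A_{\langle Y\rangle}$, i.e. $gA_Xg^{-1}$ with $g\in A_Y$, $X\subset Y$. A subset $X\subset V(\Gamma)$ is free of infinity if $\{v,w\}\in E(\Gamma)$ for all $v,w\in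 X$ with $v\neq w$. A complete parabolic subgroup is a conjugate $gA_Xg^{-1}$ with $X$ free of infinity. *)

(* Defs.v *)
From HB Require Import structures.
From mathcomp Require Import all_boot all_classical.

Set Implicit Arguments.
Unset Strict Implicit.
Unset Printing Implicit Defensive.

Local Open Scope quotient_scope.
Local Open Scope classical_set_scope.
Local Open Scope group_scope.

(* Group words over X: the letter (x, true) stands for x and (x, false) for
   the formal inverse of x. *)
Definition word (X : Type) := seq (X * bool).

Definition winv (X : Type) (u : word X) : word X :=
  rev [seq (a.1, ~~ a.2) | a <- u].

Section Presentation.
Variables (X : choiceType) (R : word X -> word X -> Prop).

Inductive wcong : word X -> word X -> Prop :=
| wcong_refl u : wcong u u
| wcong_sym u v : wcong u v -> wcong v u
| wcong_trans u v w : wcong u v -> wcong v w -> wcong u w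
| wcong_cat u u' v v' : wcong u u' -> wcong v v' -> wcong (u ++ v) (u' ++ v')
| wcong_cancel x b : wcong [:: (x, b); (x, ~~ b)] [::]
| wcong_rel u v : R u v -> wcong u v.

Definition wcongb (u v : word X) : bool := `[< wcong u v >].

Lemma wcongb_refl : reflexive wcongb.
Proof. by move=> u; apply/asboolP; exact: wcong_refl. Qed.

Lemma wcongb_sym : symmetric wcongb.
Proof. by move=> u v; apply/asboolP/asboolP; exact: wcong_sym. Qed.

Lemma wcongb_trans : transitive wcongb.
Proof.
move=> v u w /asboolP uv /asboolP vw; apply/asboolP.
exact: wcong_trans uv vw.
Qed.

Canonical wcong_equiv := EquivRel wcongb wcongb_refl wcongb_sym wcongb_trans.

Definition presented : Type := {eq_quot wcong_equiv}.
HB.instance Definition _ := Choice.on presented.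
HB.instance Definition _ := EqQuotient.on presented.

Definition pclass (u : word X) : presented := \pi_presented u.

Lemma pclassP u v : pclass u = pclass v <-> wcong u v.
Proof.
split=> [/eqmodP /asboolP //|uv].
by apply/eqmodP; apply/asboolP.
Qed.

Lemma pclass_repr (a : presented) : pclass (repr a) = a.
Proof. exact: reprK. Qed.

Lemma repr_pclass u : wcong (repr (pclass u)) u.
Proof. by apply/pclassP; rewrite pclass_repr. Qed.

Lemma winv_cat (u v : word X) : winv (u ++ v) = winv v ++ winv u.
Proof. by rewrite /winv map_cat rev_cat. Qed.

Lemma winv_cons a (u : word X) : winv (a :: u) = winv u ++ [:: (a.1, ~~ a.2)].
Proof. by rewrite -cat1s winv_cat. Qed.

Lemma winvK : involutive (@winv X).
Proof.
move=> u; rewrite /winv map_rev revK -map_comp -[RHS]map_id.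
by apply: eq_map => -[x b] /=; rewrite negbK.
Qed.

Lemma wcong_winvr u : wcong (u ++ winv u) [::].
Proof.
elim: u => [|[x b] u IH]; first exact: wcong_refl.
rewrite winv_cons /= catA -cat1s.
apply: wcong_trans (wcong_cancel x b).
rewrite -[X in wcong _ X]/([:: (x, b)] ++ [::] ++ [:: (x, ~~ b)]).
apply: wcong_cat; first exact: wcong_refl.
by apply: wcong_cat IH _; exact: wcong_refl.
Qed.

Lemma wcong_winvl u : wcong (winv u ++ u) [::].
Proof. by have := wcong_winvr (winv u); rewrite winvK. Qed.

Lemma wcong_winv u v : wcong u v -> wcong (winv u) (winv v).
Proof.
move=> uv.
have h1 : wcong (winv u) (winv u ++ (v ++ winv v)).
  rewrite -[X in wcong X _]cats0; apply: wcong_cat; first exact: wcong_refl.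
  exact/wcong_sym/wcong_winvr.
have h2 : wcong (winv u ++ (v ++ winv v)) (winv u ++ (u ++ winv v)).
  apply: wcong_cat; first exact: wcong_refl.
  by apply: wcong_cat; [exact: wcong_sym | exact: wcong_refl].
apply: wcong_trans h1 (wcong_trans h2 _); rewrite catA.
rewrite -[X in wcong _ X]cat0s; apply: wcong_cat; first exact: wcong_winvl.
exact: wcong_refl.
Qed.

Definition pone : presented := pclass [::].
Definition pmul (a b : presented) : presented := pclass (repr a ++ repr b).
Definition pinv (a : presented) : presented := pclass (winv (repr a)).

Lemma pmulE u v : pmul (pclass u) (pclass v) = pclass (u ++ v).
Proof. by apply/pclassP; apply: wcong_cat; exact: repr_pclass. Qed.

Lemma pinvE u : pinv (pclass u) = pclass (winv u).
Proof. by apply/pclassP; apply: wcong_winv; exact: repr_pclass. Qed.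

Lemma pmulA : associative pmul.
Proof.
move=> a b c; rewrite -(pclass_repr a) -(pclass_repr b) -(pclass_repr c).
by rewrite !pmulE catA.
Qed.

Lemma pmul1 : left_id pone pmul.
Proof. by move=> a; rewrite -(pclass_repr a) pmulE. Qed.

Lemma pmulr1 : right_id pone pmul.
Proof. by move=> a; rewrite -(pclass_repr a) pmulE cats0. Qed.

Lemma pmulV : left_inverse pone pinv pmul.
Proof.
move=> a; rewrite -(pclass_repr a) pinvE pmulE.
by apply/pclassP; exact: wcong_winvl.
Qed.

Lemma pmulrV : right_inverse pone pinv pmul.
Proof.
move=> a; rewrite -(pclass_repr a) pinvE pmulE.
by apply/pclassP; exact: wcong_winvr.
Qed.

HB.instance Definition _ :=
  isGroup.Build presented pmulA pmul1 pmulr1 pmulV pmulrV.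

Definition pgen (x : X) : presented := pclass [:: (x, true)].

Lemma pclass1 : pclass [::] = 1.
Proof. by []. Qed.

Lemma pclassM u v : pclass (u ++ v) = pclass u * pclass v.
Proof. by rewrite -pmulE. Qed.

Lemma pclassV u : pclass (winv u) = (pclass u)^-1.
Proof. by rewrite -pinvE. Qed.

End Presentation.

Definition weval (X : Type) (G : groupType) (f : X -> G) (u : word X) : G :=
  foldr (fun a g => (if a.2 then f a.1 else (f a.1)^-1) * g) 1 u.

Lemma weval_cat (X : Type) (G : groupType) (f : X -> G) u v :
  weval f (u ++ v) = weval f u * weval f v.
Proof. by elim: u => [|a u IH] /=; rewrite ?mul1g // IH mulgA. Qed.

Lemma weval_pgen (X : choiceType) (R : word X -> word X -> Prop) u :
  weval (@pgen X R) u = pclass R u.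
Proof.
elim: u => [|[x b] u IH] //=; rewrite IH -cat1s pclassM; congr (_ * _).
by case: b => //; rewrite -pclassV.
Qed.

Lemma pgen_rel (X : choiceType) (R : word X -> word X -> Prop) u v :
  R u v -> weval (@pgen X R) u = weval (@pgen X R) v.
Proof. by move=> uv; rewrite !weval_pgen; apply/pclassP; exact: wcong_rel. Qed.

Lemma presented_universal (X : choiceType) (R : word X -> word X -> Prop)
    (G : groupType) (f : X -> G) :
  (forall u v, R u v -> weval f u = weval f v) ->
  exists! phi : presented R -> G,
    {morph phi : a b / a * b} /\ (forall x, phi (pgen R x) = f x).
Proof.
move=> fR.
have fcong u v : wcong R u v -> weval f u = weval f v.
  elim=> {u v} // [u v w _ -> _ -> //|u u' v v' _ IHu _ IHv|x b].
    by rewrite !weval_cat IHu IHv.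
  by case: b; rewrite /= mulg1 ?mulgV ?mulVg.
pose phi (a : presented R) := weval f (repr a).
have phiE u : phi (pclass R u) = weval f u by apply: fcong; exact: repr_pclass.
have phiM : {morph phi : a b / a * b}.
  move=> a b; rewrite -(pclass_repr a) -(pclass_repr b) -pclassM !phiE.
  exact: weval_cat.
exists phi; split; first by split=> // x; rewrite phiE /= mulg1.
move=> psi [psiM psif]; apply/funext => a; rewrite -(pclass_repr a) phiE.
have psi1 : psi 1 = 1.
  by apply: (mulgI (psi 1)); rewrite -psiM !mulg1.
have psiV b : psi b^-1 = (psi b)^-1.
  by apply: (mulgI (psi b)); rewrite -psiM !mulgV.
elim: (repr a) => [|[x b] u IH] /=; first by rewrite pclass1 psi1.
rewrite -cat1s pclassM psiM IH; congr (_ * _).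
case: b; first by rewrite -psif.
by rewrite -psif -psiV -pclassV.
Qed.

Definition is_subgroup (G : groupType) (H : set G) : Prop :=
  [/\ H 1, forall a b, H a -> H b -> H (a * b) & forall a, H a -> H a^-1].

Definition generated (G : groupType) (S : set G) : set G :=
  smallest (@is_subgroup G) S.

(* The conjugate g H g^-1; the library's [x ^ y] is y^-1 * x * y. *)
Definition conj_set (G : groupType) (g : G) (H : set G) : set G :=
  [set g * h * g^-1 | h in H].

(* A simplicial graph on V given by its 2-element edges, with a labeling of the
   edges; the values of [label] outside [edges] are irrelevant. *)
Record labeled_graph (V : finType) := LabeledGraph {
  edges : {set {set V}};
  label : {set V} -> nat;
  card_edge : forall e, e \in edges -> #|e| = 2;
  label_ge2 : forall e, e \in edges -> 2 <= label e
}.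

Fixpoint alternating (V : Type) (k : nat) (v w : V) : word V :=
  if k is k'.+1 then (v, true) :: alternating k' w v else [::].

Section Artin.
Variables (V : finType) (Gamma : labeled_graph V).

Inductive artin_rel : word V -> word V -> Prop :=
| ArtinRel v w : [set v; w]%SET \in edges Gamma ->
    artin_rel (alternating (label Gamma [set v; w]%SET) v w)
              (alternating (label Gamma [set v; w]%SET) w v).

Definition artin_group : groupType := presented artin_rel.

Definition artin_gen (v : V) : artin_group := pgen artin_rel v.

Definition std_parabolic (X : {set V}) : set artin_group :=
  generated [set artin_gen v | v in [set` X]].

Definition parabolic (P : set artin_group) : Prop :=
  exists (g : artin_group) (X : {set V}), P = conj_set g (std_parabolic X).

(* Parabolic subgroups of A_Y, where A_Y is the subgroup [std_parabolic Y]. *)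
Definition parabolic_in (Y : {set V}) (P : set artin_group) : Prop :=
  exists (g : artin_group) (X : {set V}),
    [/\ std_parabolic Y g, X \subset Y & P = conj_set g (std_parabolic X)].

Definition free_of_infinity (X : {set V}) : Prop :=
  forall v w, v \in X -> w \in X -> v != w -> [set v; w]%SET \in edges Gamma.

Definition complete_parabolic (P : set artin_group) : Prop :=
  exists (g : artin_group) (X : {set V}),
    free_of_infinity X /\ P = conj_set g (std_parabolic X).

Definition property_Int : Prop :=
  forall Y : {set V}, free_of_infinity Y ->
  forall P1 P2 : set artin_group,
    parabolic_in Y P1 -> parabolic_in Y P2 -> parabolic_in Y (P1 `&` P2).

Definition property_Int_plus_minus_minus : Prop :=
  forall P1 P2 : set artin_group,
    complete_parabolic P1 -> parabolic P2 -> parabolic (P1 `&` P2).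

End Artin.

(* Main.v *)
From mathcomp Require Import all_boot all_algebra all_field.
From mathcomp Require Import ring.
From mathcomp Require Import all_classical.
Require Import Defs.

(** Write [A_X] for the standard parabolic subgroup on [X] and [W] for the
    Coxeter group of the graph. There are two ingredients.

    The first is the set-theoretic retraction of Charney and Paris. The group
    [A] acts on the right on pairs [(a, w)], where [a] is in [A] and [w] is the
    minimal element of its coset [W_X w]: a generator [s] either moves the
    minimal representative to [w s], or [w s = x w] for some [x] in [X] and then
    [a] is multiplied by [x] ([retr_step]). Checking the braid relations takes
    place in a dihedral subgroup of [W] ([retr_braid]). Following the orbit of
    [(1, 1)] gives at once
    - [A_X] and [A_Y] meet in [A_(X :&: Y)] ([par_setI]);
    - if [g A_Y g^-1] lies in [A_X], then it equals [a A_Z a^-1] with [a] in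
      [A_X], [Z] in [X], and [Y] is free of infinity when [Z] is
      ([conj_par_in_par]).
    The facts about [W] that are needed are strong exchange, which comes from
    the cocycle sending [w] to the set of reflections that it crosses, and the
    exact order of a product of two generators, which comes from a reflection
    representation.

    The second is Bass-Serre theory. If [v] and [w] are distinct and not
    adjacent, no relation involves both, so [A] is the amalgam of its subgroups
    on the complements of [v] and of [w]. Only one consequence is used: an
    alternating product has a well-defined first factor. It is read off from the
    cocycle that sends [g] to the set of edges, in the would-be tree, of a path
    from the base vertex to its translate by [g]; since the relations hold for
    this mod 2 count, every edge of the graph separates it ([split_cocycle],
    [reduced_notin]).

    Now let [X] be free of infinity and [X], [Y] in [U], [g] in [A_U]. By
    induction on the size of [U], the intersection of [A_X] and [g A_Y g^-1] is
    parabolic. If [U] is free of infinity this is the assumption. Otherwise [U]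
    has non-adjacent [v], [w], and [A_U] acts on the tree; by the first
    ingredient the stabilizers in [A_U] are the standard parabolic subgroups on
    [U :\ v], [U :\ w] and [U :\ v :\ w]. The group [A_X] fixes a base vertex and
    [g A_Y g^-1] preserves a subtree. If the subtree contains that vertex, [Y]
    may be intersected with the smaller vertex set. If not, the intersection
    fixes the first edge towards the subtree; replacing [A_X] by its
    intersection with the edge group, which is parabolic by the induction on [U]
    and of the form [b A_Z b^-1] by the first ingredient, brings the
    subtree one step closer ([meets_parabolically_split]). *)

Set Implicit Arguments.
Unset Strict Implicit.
Unset Printing Implicit Defensive.

Local Open Scope classical_set_scope.
Local Open Scope group_scope.

(** * Words acting on a set *)

(** Group actions on a set are built from an action of the letters. The actions
    below satisfy the relations only on the points of a stable subset [P]. *)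
Section WordAction.
Variables (X : choiceType) (R : word X -> word X -> Prop) (S : Type).
Variables (P : S -> Prop) (step : S -> X * bool -> S).
Hypothesis stepP : forall p a, P p -> P (step p a).
Hypothesis stepK : forall p x b, P p -> step (step p (x, b)) (x, ~~ b) = p.
Hypothesis stepR : forall u v p, R u v -> P p -> foldl step p u = foldl step p v.

Lemma foldl_stepP p u : P p -> P (foldl step p u).
Proof. by elim: u p => [//|a u IH] p Pp /=; apply/IH/stepP. Qed.

Lemma foldl_wcong u v p : wcong R u v -> P p -> foldl step p u = foldl step p v.
Proof.
move=> uv; elim: uv p => {u v} //.
- by move=> u v _ IH p Pp; rewrite IH.
- by move=> u v w _ IHu _ IHv p Pp; rewrite IHu // IHv.
- move=> u u' v v' _ IHu _ IHv p Pp; rewrite !foldl_cat IHu // IHv //.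
  exact: foldl_stepP.
- by move=> x b p Pp /=; rewrite stepK.
- by move=> u v uv p Pp; apply: stepR.
Qed.

Definition pact (p : S) (g : presented R) : S := foldl step p (repr g).

Lemma pact_class p u : P p -> pact p (pclass R u) = foldl step p u.
Proof. by move=> Pp; apply: foldl_wcong Pp; exact: repr_pclass. Qed.

Lemma pactP p g : P p -> P (pact p g).
Proof. exact: foldl_stepP. Qed.

Lemma pactM p g h : P p -> pact p (g * h) = pact (pact p g) h.
Proof.
by move=> Pp; rewrite -[g]pclass_repr -[h]pclass_repr -pclassM
  !pact_class ?foldl_cat //; apply: foldl_stepP.
Qed.

Lemma pact_gen p x : P p -> pact p (pgen R x) = step p (x, true).
Proof. by move=> Pp; rewrite pact_class. Qed.

End WordAction.

(** * The Coxeter group *)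

Section Coxeter.
Variables (V : finType) (Gamma : labeled_graph V).
Implicit Types (s t v : V) (l : seq V).

Definition cox_rel (u v : word V) : Prop :=
  artin_rel Gamma u v \/ exists s, u = [:: (s, true); (s, true)] /\ v = [::].

Definition cox_group : groupType := presented cox_rel.
Definition cgen s : cox_group := pgen cox_rel s.

Lemma edge_neq s t : [set s; t]%SET \in edges Gamma -> s != t.
Proof.
by apply: contraTneq => ->; apply/negP => /card_edge; rewrite finset.setUid cards1.
Qed.

Lemma cgen2 s : cgen s * cgen s = 1.
Proof.
rewrite /cgen /pgen -pclassM; apply/pclassP/wcong_rel; right; by exists s.
Qed.

Lemma cgenV s : (cgen s)^-1 = cgen s.
Proof. by apply: mulg1_eq; exact: cgen2. Qed.

Lemma cgenK s (x : cox_group) : cgen s * (cgen s * x) = x.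
Proof. by rewrite mulgA cgen2 mul1g. Qed.

Lemma cgenKr s (x : cox_group) : x * cgen s * cgen s = x.
Proof. by rewrite -mulgA cgen2 mulg1. Qed.

End Coxeter.

(** * A reflection representation over the algebraic numbers *)

Section Geometric.
Import GRing.Theory Num.Theory.
Variables (V : finType) (Gamma : labeled_graph V).
Local Notation edge s t := ([set s; t]%SET \in edges Gamma).
Local Notation m s t := (label Gamma [set s; t]%SET).
Local Open Scope ring_scope.

(** The product of two adjacent generators will have the eigenvalue [q ^+ 2],
    so a primitive root of order twice the label forces the right order. For
    non-adjacent generators any value with [q ^+ 2] of infinite order will do. *)
Lemma geo_param : exists q : {set V} -> algC,
  (forall e, e \in edges Gamma -> (2 * label Gamma e).-primitive_root (q e))
  /\ (forall e, e \notin edges Gamma -> q e = 2%:R).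
Proof.
have root e : exists z : algC, (e \in edges Gamma -> (2 * label Gamma e).-primitive_root z)
    /\ (e \notin edges Gamma -> z = 2%:R).
  case: (boolP (e \in edges Gamma)) => eE; last by exists 2%:R.
  have : (0 < 2 * label Gamma e)%N by have := label_ge2 eE; case: label.
  by move=> /C_prim_root_exists[z zP]; exists z.
have [q qP] := choice root; exists q; split=> e; by have [] := qP e.
Qed.

Section Representation.
Variable q : {set V} -> algC.
Hypothesis q_edge :
  forall e, e \in edges Gamma -> (2 * label Gamma e).-primitive_root (q e).
Hypothesis q_free : forall e, e \notin edges Gamma -> q e = 2%:R.

Definition cartan (s t : V) : algC :=
  if s == t then 2%:R else - (q [set s; t]%SET + (q [set s; t]%SET)^-1).

(** The contragredient of the usual reflection representation: a functional [f]
    is known by its values on the simple roots, and applying the reflection [s]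
    only involves the value [f s]; no sum over the simple roots occurs. *)
Definition geo_step (f : V -> algC) (a : V * bool) : V -> algC :=
  fun v => f v - cartan a.1 v * f a.1.

Lemma geo_stepK f s b c : geo_step (geo_step f (s, b)) (s, c) = f.
Proof. by apply/funext => v; rewrite /geo_step /= /cartan eqxx; ring. Qed.

Lemma q_neq0 e : q e != 0.
Proof.
case: (boolP (e \in edges Gamma)) => [eE|/q_free->]; last by rewrite pnatr_eq0.
apply/eqP => q0; have /eqP := prim_expr_order (q_edge eE).
have := label_ge2 eE; case: (label Gamma e) => [//|k _].
by rewrite q0 mulnS expr0n /= eq_sym oner_eq0.
Qed.

Lemma q_edge_exp e k : e \in edges Gamma -> (q e ^+ 2 ^+ k == 1) = (label Gamma e %| k)%N.
Proof.
move=> eE; rewrite -exprM -(prim_order_dvd (q_edge eE)).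
by rewrite dvdn_pmul2l.
Qed.

Lemma q_free_exp e k : e \notin edges Gamma -> q e ^+ 2 ^+ k = 1 -> k = 0%N.
Proof.
move=> /q_free->; case: k => [//|k].
rewrite -exprM -natrX => /eqP; rewrite pnatr_eq1 => /eqP.
have : (1 < 2 ^ (2 * k.+1))%N by rewrite -{1}(expn0 2) ltn_exp2l.
by move=> /[swap] ->.
Qed.

Lemma q_sqr_neq1 e : q e ^+ 2 != 1.
Proof.
case: (boolP (e \in edges Gamma)) => eE; apply/eqP => q1.
  move: (q_edge_exp 1 eE); rewrite expr1 q1 eqxx dvdn1 => /esym/eqP l1.
  by have := label_ge2 eE; rewrite l1.
by have := @q_free_exp e 1 eE; rewrite expr1 => /(_ q1).
Qed.

Definition geo_pair s t f := geo_step (geo_step f (s, true)) (t, true).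

Section Pair.
Variables s t : V.
Hypothesis st : s != t.
Let z := q [set s; t]%SET.

Let z0 : z != 0. Proof. exact: q_neq0. Qed.
Let z1 : z ^+ 2 - 1 != 0. Proof. by rewrite subr_eq0 q_sqr_neq1. Qed.

Definition geo_eig (a : algC) (f : V -> algC) := f t + a * f s.

(** The two eigenfunctionals of the product of two reflections on the plane of
    their roots, with eigenvalues [z ^+ 2] and [z ^- 2]. *)
Lemma geo_eigP f a : a = z \/ a = z^-1 ->
  geo_eig a (geo_pair s t f) = a ^+ 2 * geo_eig a f.
Proof.
rewrite /geo_eig /geo_pair /geo_step /cartan /= !eqxx.
rewrite (eq_sym t s) (negPf st) (finset.setUC [set t]%SET) -/z.
by case=> ->; field.
Qed.

Lemma geo_eig_iter f a k : a = z \/ a = z^-1 ->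
  geo_eig a (iter k (geo_pair s t) f) = a ^+ 2 ^+ k * geo_eig a f.
Proof.
move=> az; elim: k => [|k IH]; first by rewrite mul1r.
by rewrite iterS geo_eigP // IH mulrA -exprS.
Qed.

Lemma geo_pairE f v : geo_pair s t f v =
  f v - (cartan s v + z * cartan t v) / (z - z^-1) * geo_eig z f
      + (cartan s v + z^-1 * cartan t v) / (z - z^-1) * geo_eig z^-1 f.
Proof.
rewrite /geo_eig /geo_pair /geo_step /= [cartan s t]/cartan (negPf st) -/z.
by field; rewrite z0 -expr2 z1.
Qed.

Lemma geo_pair_iterE f v k : iter k (geo_pair s t) f v =
  f v - (cartan s v + z * cartan t v) / (z - z^-1) * geo_eig z f
          * (\sum_(i < k) (z ^+ 2) ^+ i)
      + (cartan s v + z^-1 * cartan t v) / (z - z^-1) * geo_eig z^-1 f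
          * (\sum_(i < k) (z^-1 ^+ 2) ^+ i).
Proof.
elim: k => [|k IH]; first by rewrite !big_ord0 /= !mulr0 subr0 addr0.
rewrite iterS geo_pairE IH !geo_eig_iter; [|by right|by left].
by rewrite !big_ord_recr /=; ring.
Qed.

(** The functional that is 1 at [t] and 0 elsewhere is not killed by the
    eigenfunctional for [z ^+ 2]. *)
Lemma geo_pair_order k : iter k (geo_pair s t) =1 id -> z ^+ 2 ^+ k = 1.
Proof.
move=> kid; have := @geo_eig_iter (fun v => (v == t)%:R) z k (or_introl erefl).
by rewrite kid /geo_eig eqxx (negPf st) mulr0 addr0 mulr1.
Qed.

(** On the whole space the powers are governed by the geometric sums of the two
    eigenvalues, and both sums over a full period vanish. *)
Lemma geo_pair_braid f : edge s t -> iter (m s t) (geo_pair s t) f = f.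
Proof.
move=> eE; apply/funext => v; rewrite geo_pair_iterE.
have geo0 (x : algC) : x != 1 -> x ^+ (m s t) = 1 -> \sum_(i < m s t) x ^+ i = 0.
  move=> x1 xm; have /eqP := subrX1 x (m s t).
  by rewrite xm subrr eq_sym mulf_eq0 subr_eq0 (negPf x1) => /eqP.
have zm : (z ^+ 2) ^+ (m s t) = 1 by apply/eqP; rewrite q_edge_exp.
rewrite !geo0 ?mulr0 ?subr0 ?addr0 ?exprVn ?invr_eq1 ?q_sqr_neq1 //.
by rewrite zm invr1.
Qed.
End Pair.

Lemma foldl_alternatingS k s t f :
  foldl geo_step f (alternating k.+1 s t) =
  foldl geo_step (geo_step f (s, true)) (alternating k t s).
Proof. by []. Qed.

Lemma geo_alternating k s t f :
  foldl geo_step f (alternating k s t) =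
  foldl geo_step (iter k (geo_pair s t) f) (alternating k t s).
Proof.
elim: k s t f => [//|k IH] s t f; rewrite !foldl_alternatingS {}IH.
congr foldl; rewrite iterSr [geo_pair s t f]/geo_pair.
elim: k (geo_step f (s, true)) => [|k IH] g; first by rewrite /= geo_stepK.
by rewrite !iterSr IH.
Qed.

Lemma geo_wcong u v : wcong (cox_rel Gamma) u v ->
  foldl geo_step ^~ u =1 foldl geo_step ^~ v.
Proof.
move=> uv f; apply: (@foldl_wcong _ _ _ (fun=> True) _ _ _ _ _ _ _ uv) => //.
  by move=> p x b _; rewrite geo_stepK.
move=> {uv}u {}v p [[s t stE]|[s [-> ->]]] _; last by rewrite /= geo_stepK.
have st := edge_neq stE.
by rewrite geo_alternating geo_pair_braid.
Qed.

Lemma geo_order s t k : s != t -> ((cgen Gamma s * cgen Gamma t) ^+ k = 1)%g ->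
  q [set s; t]%SET ^+ 2 ^+ k = 1.
Proof.
move=> st; rewrite /cgen /pgen -pclassM.
have -> : (pclass (cox_rel Gamma) [:: (s, true); (t, true)] ^+ k =
  pclass (cox_rel Gamma) (flatten (nseq k [:: (s, true); (t, true)])))%g.
  by elim: k => [|k IH]; rewrite ?expgS ?IH -?pclassM.
move=> /pclassP /geo_wcong kid; apply: geo_pair_order => // f.
rewrite -[RHS]kid; elim: k f {kid} => [//|k IH] f.
by rewrite iterSr IH.
Qed.

End Representation.
End Geometric.

(** * Reflections, exchange and minimal representatives *)

Section CoxeterOrder.
Variables (V : finType) (Gamma : labeled_graph V).
Local Notation edge s t := ([set s; t]%SET \in edges Gamma).
Local Notation m s t := (label Gamma [set s; t]%SET).
Local Notation c s t := (cgen Gamma s * cgen Gamma t).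

Lemma cgen_order_edge s t k : s != t -> edge s t -> c s t ^+ k = 1 -> m s t %| k.
Proof.
have [q [qE qF]] := geo_param Gamma.
move=> st eE /(geo_order qE qF st) /eqP.
by rewrite (q_edge_exp qE).
Qed.

Lemma cgen_order_free s t k : s != t -> c s t ^+ k = 1 -> 0 < k -> edge s t.
Proof.
have [q [qE qF]] := geo_param Gamma.
move=> st /(geo_order qE qF st) qk k0.
by apply/negPn/negP => /(q_free_exp qF)/(_ qk) k00; rewrite k00 in k0.
Qed.

Lemma cgen_inj : injective (cgen Gamma).
Proof.
move=> s t st; apply/eqP/negPn/negP => snt.
have c1 : c s t ^+ 1 = 1 by rewrite expg1 st cgen2.
have eE := cgen_order_free snt c1 isT.
have := cgen_order_edge snt eE c1; rewrite dvdn1 => /eqP l1.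
by have := label_ge2 eE; rewrite l1.
Qed.

Definition cword (l : seq V) : cox_group Gamma := \prod_(s <- l) cgen Gamma s.

Fixpoint alternate (k : nat) (s t : V) : seq V :=
  if k is k'.+1 then s :: alternate k' t s else [::].

Lemma alternating_alternate k s t :
  alternating k s t = [seq (x, true) | x <- alternate k s t].
Proof. by elim: k s t => //= k IH s t; rewrite IH. Qed.

Lemma alternate_sub k s t : {subset alternate k s t <= pred2 s t}.
Proof.
elim: k s t => //= k IH s t x; rewrite !inE => /orP[->//|/IH].
by rewrite !inE orbC.
Qed.

Lemma pclass_positive l : pclass (cox_rel Gamma) [seq (x, true) | x <- l] = cword l.
Proof.
rewrite /cword; elim: l => [|s l IH]; first by rewrite big_nil.
by rewrite big_cons -IH -pclassM.
Qed.

Lemma cword_braid s t : edge s t ->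
  cword (alternate (m s t) s t) = cword (alternate (m s t) t s).
Proof.
move=> eE; rewrite -!pclass_positive -!alternating_alternate; apply/pclassP/wcong_rel; left.
exact: ArtinRel.
Qed.

Lemma cword_cat l l' : cword (l ++ l') = cword l * cword l'.
Proof. by rewrite /cword big_cat. Qed.

Lemma cword_cons s l : cword (s :: l) = cgen Gamma s * cword l.
Proof. by rewrite /cword big_cons. Qed.

Lemma cword_nil : cword [::] = 1.
Proof. by rewrite /cword big_nil. Qed.

Lemma cwordV l : (cword l)^-1 = cword (rev l).
Proof.
elim: l => [|s l IH]; first by rewrite cword_nil invg1.
by rewrite rev_cons -cats1 cword_cat -IH !cword_cons cword_nil mulg1 invgM cgenV.
Qed.

Lemma cwordP w : exists l, w = cword l.
Proof.
rewrite -(pclass_repr w); elim: (repr w) => [|[s b] u [l IH]].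
  by exists [::]; rewrite cword_nil.
exists (s :: l); rewrite -cat1s pclassM IH cword_cons; congr (_ * _).
case: b => //; rewrite -[RHS]cgenV -[LHS]/(pclass _ (winv [:: (s, true)])).
by rewrite pclassV.
Qed.

Lemma cgen_mulV s t : (c s t)^-1 = c t s.
Proof. by rewrite invgM !cgenV. Qed.

Lemma cgen_mul_shift k s t : cgen Gamma s * c t s ^+ k = c s t ^+ k * cgen Gamma s.
Proof.
elim: k => [|k IH]; first by rewrite mulg1 mul1g.
by rewrite expgSr mulgA IH expgSr !mulgA.
Qed.

Lemma cword_alternate k s t :
  cword (alternate k s t) = c s t ^+ k * cword (alternate k t s).
Proof.
elim: k s t => [|k IH] s t; first by rewrite mul1g.
by rewrite /= !cword_cons IH mulgA cgen_mul_shift expgSr !mulgA cgenKr.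
Qed.

Lemma cgen_mul_order s t : edge s t -> c s t ^+ m s t = 1.
Proof.
move=> eE; have := cword_alternate (m s t) s t; rewrite (cword_braid eE) => h.
by apply: (mulIg (cword (alternate (m s t) t s))); rewrite -h mul1g.
Qed.

(** Reading [l] from [w] visits the elements [w], [w s], ...; each step crosses
    a reflection, and this counts how often the reflection crossed is [x]. *)
Fixpoint crossings (w : cox_group Gamma) (l : seq V) (x : cox_group Gamma) : nat :=
  if l is s :: l' then (x == w * cgen Gamma s * w^-1) + crossings (w * cgen Gamma s) l' x
  else 0.

Lemma crossings_alternate w k s t x : crossings w (alternate k s t) x =
  \sum_(j < k) (x == w * (c s t ^+ j * cgen Gamma s) * w^-1)%g.
Proof.
elim: k s t w => [|k IH] s t w; first by rewrite big_ord0.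
rewrite big_ord_recl /= mul1g IH; congr (_ + _).
apply: eq_bigr => j _; congr (nat_of_bool (_ == _)).
rewrite invgM cgenV /bump /= add1n expgSr !mulgA; congr (_ * _ * _).
by rewrite -[w * _ * _]mulgA cgen_mul_shift !mulgA.
Qed.

(** The two sides of a braid relation run around the two halves of a [2 m]-gon,
    and cross the same reflections in opposite orders. *)
Lemma crossings_braid w s t x : edge s t ->
  crossings w (alternate (m s t) s t) x = crossings w (alternate (m s t) t s) x.
Proof.
move=> eE; rewrite !crossings_alternate [RHS](reindex_inj rev_ord_inj) /=.
apply: eq_bigr => j _; congr (nat_of_bool (_ == _ * _ * _)).
have -> : c s t ^+ j = c t s ^+ (m s t - j).
  have := cgen_mul_order eE; rewrite -{1}(subnK (ltnW (ltn_ord j))) expgnDr.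
  by move=> /mulg1_eq <-; rewrite -expVgn cgen_mulV.
by rewrite -[m s t - j]prednK ?subn_gt0 // subnS expgSr -!mulgA cgen2 mulg1.
Qed.

(** A group element acts on pairs made of an element [x], by conjugation, and a
    bit, which flips each time [x] is the reflection being crossed. *)
Definition refl_step (p : cox_group Gamma * bool) (a : V * bool) :=
  (cgen Gamma a.1 * p.1 * cgen Gamma a.1, p.2 (+) (p.1 == cgen Gamma a.1)).

Lemma refl_stepK p s b c : refl_step (refl_step p (s, b)) (s, c) = p.
Proof.
case: p => x e; rewrite /refl_step /= !mulgA cgen2 mul1g cgenKr; congr (_, _).
rewrite -addbA [X in _ (+) X](_ : _ = false) ?addbF //.
suff -> : (cgen Gamma s * x * cgen Gamma s == cgen Gamma s) = (x == cgen Gamma s).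
  exact: addbb.
by rewrite -(inj_eq (mulIg (cgen Gamma s))) cgenKr cgen2 mulg_eq1 -eqg_invLR cgenV eq_sym.
Qed.

Lemma foldl_refl w x e l :
  foldl refl_step (w^-1 * x * w, e) [seq (s, true) | s <- l] =
  ((w * cword l)^-1 * x * (w * cword l), e (+) odd (crossings w l x)).
Proof.
elim: l w e => [|s l IH] w e; first by rewrite /= cword_nil mulg1 addbF.
rewrite /= /refl_step /=.
have -> : cgen Gamma s * (w^-1 * x * w) * cgen Gamma s =
    (w * cgen Gamma s)^-1 * x * (w * cgen Gamma s).
  by rewrite invgM cgenV !mulgA.
rewrite IH cword_cons !mulgA oddD -addbA; congr (_, _ (+) (_ (+) _)).
by rewrite oddb -(inj_eq (mulgI w)) -(inj_eq (mulIg w^-1)) !mulgA mulgV mul1g mulgK.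
Qed.

Lemma foldl_refl_rel u v p : cox_rel Gamma u v ->
  foldl refl_step p u = foldl refl_step p v.
Proof.
case=> [[s t eE]|[s [-> ->]]]; last by rewrite /= refl_stepK.
case: p => x e; have -> : x = 1^-1 * x * 1 by rewrite invg1 mul1g mulg1.
by rewrite !alternating_alternate !foldl_refl crossings_braid // cword_braid.
Qed.

(** For a reflection [x], this holds when [x] separates [1] from [w]. *)
Definition refl_cocycle (w x : cox_group Gamma) : bool := (pact refl_step (x, false) w).2.
Local Notation N := refl_cocycle.

Lemma refl_cocycle_word l x : N (cword l) x = odd (crossings 1 l x).
Proof.
rewrite /refl_cocycle -pclass_positive (@pact_class _ _ _ (fun=> True)) //.
- have {1}-> : x = 1^-1 * x * 1 by rewrite invg1 mul1g mulg1.
  by rewrite foldl_refl.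
- by move=> p s b _; rewrite refl_stepK.
- by move=> u v p uv _; apply: foldl_refl_rel.
Qed.

Lemma crossings_mul w l x : crossings w l x = crossings 1 l (w^-1 * x * w).
Proof.
rewrite -{1}[w]mulg1.
elim: l (1 : cox_group Gamma) => [//|s l IH] w' /=.
rewrite -[w * w' * _]mulgA IH; congr (nat_of_bool _ + _).
by rewrite -(inj_eq (mulgI w^-1)) -(inj_eq (mulIg w)) invgM !mulgA mulVg mul1g mulgVK.
Qed.

Lemma crossings_cat w l l' x :
  crossings w (l ++ l') x = crossings w l x + crossings (w * cword l) l' x.
Proof.
elim: l w => [|s l IH] w /=; first by rewrite cword_nil mulg1.
by rewrite IH cword_cons mulgA addnA.
Qed.

Lemma refl_cocycleM w w' x : N (w * w') x = N w x (+) N w' (w^-1 * x * w).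
Proof.
have [l ->] := cwordP w; have [l' ->] := cwordP w'.
by rewrite -cword_cat !refl_cocycle_word crossings_cat mul1g oddD -crossings_mul.
Qed.

Lemma refl_cocycle1 x : N 1 x = false.
Proof. by rewrite -cword_nil refl_cocycle_word. Qed.

Lemma refl_cocycle_gen s x : N (cgen Gamma s) x = (x == cgen Gamma s).
Proof.
rewrite -[cgen Gamma s]mulg1 -cword_nil -cword_cons refl_cocycle_word /=.
by rewrite addn0 oddb mul1g invg1 cword_cons cword_nil mulg1.
Qed.

Lemma cgen_neq1 s : cgen Gamma s != 1.
Proof.
apply/eqP => s1; have := refl_cocycle_gen s (cgen Gamma s).
by rewrite {1}s1 refl_cocycle1 eqxx.
Qed.

(** A word that crosses [x] has a letter at which it does so; deleting it gives
    a word for [x] times the element. *)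
Lemma strong_exchange l x : N (cword l) x ->
  exists l', [/\ size l' < size l, {subset l' <= l} & x * cword l = cword l'].
Proof.
elim: l x => [|s l IH] x; first by rewrite cword_nil refl_cocycle1.
rewrite cword_cons refl_cocycleM refl_cocycle_gen.
case: eqVneq => [->|_] /= xl.
  exists l; rewrite cgenK; split=> // y yl; by rewrite inE yl orbT.
have [l' [sl sub e]] := IH _ xl; exists (s :: l'); split=> //.
  by move=> y; rewrite !inE => /orP[->//|/sub->]; rewrite orbT.
by rewrite cword_cons -e cgenV !mulgA cgen2 mul1g.
Qed.

Definition cox_sub (B : {pred V}) : set (cox_group Gamma) :=
  [set w | exists2 l, {subset l <= B} & w = cword l]%classic.

Lemma cox_sub1 B : cox_sub B 1.
Proof. by exists [::]; rewrite ?cword_nil. Qed.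

Lemma cox_subM B w w' : cox_sub B w -> cox_sub B w' -> cox_sub B (w * w').
Proof.
move=> [l lB ->] [l' l'B ->]; exists (l ++ l'); rewrite ?cword_cat // => x.
by rewrite mem_cat => /orP[/lB|/l'B].
Qed.

Lemma cox_subV B w : cox_sub B w -> cox_sub B w^-1.
Proof.
by move=> [l lB ->]; exists (rev l); rewrite ?cwordV // => x; rewrite mem_rev; apply: lB.
Qed.

Lemma cox_sub_gen (B : {pred V}) s : s \in B -> cox_sub B (cgen Gamma s).
Proof.
move=> sB; exists [:: s]; rewrite ?cword_cons ?cword_nil ?mulg1 // => x.
by rewrite inE => /eqP->.
Qed.

Lemma cox_sub_cocycle B w x : cox_sub B w -> N w x -> cox_sub B x.
Proof.
move=> [l lB ->] /strong_exchange[l' [_ sub e]].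
have -> : x = cword l' * (cword l)^-1 by rewrite -e mulgK.
apply: cox_subM; first by exists l' => // y /sub/lB.
by apply: cox_subV; exists l.
Qed.

(** The first letter [b] of a shortest word in [B] works: if it did not, [b * w]
    would cross [b], and exchange would shorten the word of [w]. *)
Lemma cox_sub_descent B w : cox_sub B w -> w != 1 ->
  exists2 b, b \in B & N w (cgen Gamma b).
Proof.
move=> [l]; have [n] := ubnP (size l); elim: n => // n IH in l w * => sl lB wl w1.
case: l => [|b l] in sl lB wl *; first by rewrite wl cword_nil eqxx in w1.
case Nb: (N w (cgen Gamma b)); first by exists b => //; apply: lB; rewrite mem_head.
have Nl : N (cword l) (cgen Gamma b).
  have := refl_cocycleM (cgen Gamma b) w (cgen Gamma b).
  by rewrite {1}wl cword_cons cgenK refl_cocycle_gen eqxx cgenV cgen2 mul1g Nb.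
have [l' [sl' sub e]] := strong_exchange Nl.
apply: (IH l' w) => //; last by rewrite -e -cword_cons.
  by apply: leq_trans sl' _; apply: ltnW; rewrite -ltnS.
by move=> x /sub xl; apply: lB; rewrite inE xl orbT.
Qed.

Lemma cox_sub_cgen B s : cox_sub B (cgen Gamma s) -> s \in B.
Proof.
move=> /cox_sub_descent/(_ (cgen_neq1 s))[b bB].
by rewrite refl_cocycle_gen => /eqP/cgen_inj <-.
Qed.

(** Take [d] of minimal word length in the coset [w W_B]. If [d] crossed
    [d z d^-1], exchange would give a shorter word for [d z]. *)
Lemma cox_min_rep B w : exists d u, [/\ w = d * u, cox_sub B u &
  forall z, cox_sub B z -> N d (d * z * d^-1) = false].
Proof.
pose P n := `[< exists l u, [/\ size l = n, cox_sub B u & w = cword l * u] >].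
have exP : exists n, P n.
  have [l wE] := cwordP w; exists (size l); apply/asboolP; exists l, 1.
  by rewrite mulg1; split=> //; apply: cox_sub1.
case: (ex_minnP exP) => n /asboolP[l [u [sl uB wE]]] nmin.
exists (cword l), u; split=> // z zB; apply/negP => /strong_exchange[l' [sl' _ e]].
suff /nmin : P (size l') by rewrite leqNgt -sl sl'.
apply/asboolP; exists l', (z^-1 * u); split=> //.
  by apply: cox_subM => //; apply: cox_subV.
by rewrite -e mulgVK -mulgA mulVKg.
Qed.

End CoxeterOrder.

(** * The retraction onto a standard parabolic subgroup *)

Section Retraction.
Variables (V : finType) (Gamma : labeled_graph V) (X : {set V}).
Local Notation edge s t := ([set s; t]%SET \in edges Gamma).
Local Notation m s t := (label Gamma [set s; t]%SET).
Local Notation W := (cox_group Gamma).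
Local Notation A := (artin_group Gamma).
Local Notation sigma := (cgen Gamma).
Local Notation cword := (@cword V Gamma).
Local Notation agen := (artin_gen Gamma).
Local Notation N := (@refl_cocycle V Gamma).

(** [w] is the shortest element of its coset [W_X w]. *)
Definition min_rep (w : W) := forall x, x \in X -> N w (sigma x) = false.

(** At most one [x] fits, as the generators of the Coxeter group are distinct
    ([cgen_inj]), so the choice made by [pick] is immaterial. *)
Definition retr_step (p : A * W) (a : V * bool) : A * W :=
  if [pick x in X | p.2 * sigma a.1 == sigma x * p.2] is Some x
  then (p.1 * (if a.2 then agen x else (agen x)^-1), p.2)
  else (p.1, p.2 * sigma a.1).

Lemma retr_stay a w s b x : x \in X -> w * sigma s = sigma x * w ->
  retr_step (a, w) (s, b) = (a * (if b then agen x else (agen x)^-1), w).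
Proof.
move=> xX wsx; rewrite /retr_step /=; case: pickP => [y /andP[_ /eqP]|/(_ x)].
  by rewrite wsx => /mulIg/cgen_inj <-.
by rewrite xX wsx eqxx.
Qed.

Lemma retr_move a w s b : (forall x, x \in X -> w * sigma s <> sigma x * w) ->
  retr_step (a, w) (s, b) = (a, w * sigma s).
Proof.
by move=> h; rewrite /retr_step /=; case: pickP => [y /andP[/h h' /eqP]|].
Qed.

Lemma retr_stepP w s :
  (exists2 x, x \in X & w * sigma s = sigma x * w) \/
  (forall x, x \in X -> w * sigma s <> sigma x * w).
Proof.
case: (pselect (exists2 x, x \in X & w * sigma s = sigma x * w)); first by left.
by move=> h; right=> x xX wsx; apply: h; exists x.
Qed.

(** Moving from [w] to [w s] only crosses [w s w^-1], and in this case the latter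
    is not a generator from [X]. *)
Lemma retr_step_min p a : min_rep p.2 -> min_rep (retr_step p a).2.
Proof.
case: p a => [a w] [s b] /= wmin.
case: (retr_stepP w s) => [[x xX wsx]|h]; first by rewrite (retr_stay _ _ xX wsx).
rewrite retr_move //= => x xX; rewrite refl_cocycleM wmin // refl_cocycle_gen.
apply/eqP => e; apply: (h x xX); rewrite -e; by rewrite -!mulgA mulVKg.
Qed.

Lemma retr_stepK p s b : retr_step (retr_step p (s, b)) (s, ~~ b) = p.
Proof.
case: p => a w; case: (retr_stepP w s) => [[x xX wsx]|h].
  rewrite !(retr_stay _ _ xX wsx); congr (_, _).
  by case: b; rewrite /= ?mulgK ?mulgVK.
rewrite retr_move // retr_move ?cgenKr // => x xX e.
by apply: (h x xX); rewrite {1}e mulgA cgenKr.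
Qed.

Lemma retr_mull b p u : foldl retr_step (b * p.1, p.2) u =
  (b * (foldl retr_step p u).1, (foldl retr_step p u).2).
Proof.
elim: u p => [|[s c] u IH] [a w] //=.
case: (retr_stepP w s) => [[x xX wsx]|h].
  by rewrite !(retr_stay _ _ xX wsx) -mulgA; apply: (IH (_, _)).
by rewrite !retr_move //; apply: (IH (_, _)).
Qed.

Lemma walk_stay s t x y a w k : x \in X -> y \in X ->
  w * sigma s = sigma x * w -> w * sigma t = sigma y * w ->
  foldl retr_step (a, w) (alternating k s t) =
  (a * pclass (artin_rel Gamma) (alternating k x y), w).
Proof.
elim: k s t x y a => [|k IH] s t x y a xX yX wx wy /=.
  by rewrite pclass1 mulg1.
rewrite (retr_stay _ _ xX wx) /= (IH _ _ y x) //.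
by rewrite -(cat1s (x, true)) pclassM mulgA.
Qed.

Section Braid.
Variables s t : V.
Let B : {pred V} := pred2 s t.

Lemma walk_move a w l : {subset l <= B} ->
  (forall u e x, cox_sub B u -> e \in B -> x \in X ->
     w * u * sigma e <> sigma x * (w * u)) ->
  foldl retr_step (a, w) [seq (e, true) | e <- l] = (a, w * cword l).
Proof.
elim: l w => [|e l IH] w lB h; first by rewrite /= cword_nil mulg1.
have eB : e \in B by apply: lB; rewrite mem_head.
rewrite /= retr_move; last first.
  by move=> x xX; have := h _ e x (@cox_sub1 _ _ B) eB xX; rewrite mulg1.
rewrite IH ?cword_cons ?mulgA //; first by move=> x xl; apply: lB; rewrite inE xl orbT.
move=> u f x uB fB xX; rewrite -[w * _ * u]mulgA; apply: h => //.
by apply: cox_subM => //; apply: cox_sub_gen.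
Qed.

(** Suppose that [x] is the only generator in [X] at which the walk can stay in
    the coset [w W_B]. The walk follows the path of [l] up to reflections in
    [x], and stays exactly when that path crosses [x]. *)
Lemma walk_cross x a w u l n : {subset l <= B} -> cox_sub B u ->
  x \in X -> cox_sub B (w^-1 * sigma x * w) ->
  (forall u e y, cox_sub B u -> e \in B -> y \in X ->
     w * u * sigma e = sigma y * (w * u) -> y = x) ->
  foldl retr_step (a, sigma x ^+ n * (w * u)) [seq (e, true) | e <- l] =
  (a * agen x ^+ crossings (w * u) l (sigma x),
   sigma x ^+ (n + crossings (w * u) l (sigma x)) * (w * u * cword l)).
Proof.
move=> + + xX xB h; elim: l u n a => [|e l IH] u n a lB uB.
  by rewrite /= cword_nil !mulg1 addn0.
have eB : e \in B by apply: lB; rewrite mem_head.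
have uB' : cox_sub B (u * sigma e) by apply: cox_subM => //; apply: cox_sub_gen.
have lB' : {subset l <= B} by move=> y yl; apply: lB; rewrite inE yl orbT.
have posE : sigma x ^+ n * (w * u) = w * ((w^-1 * sigma x * w) ^+ n * u).
  rewrite !mulgA; congr (_ * u).
  elim: n => [|n IHn]; first by rewrite mulg1 mul1g.
  by rewrite expgSr [in RHS]expgSr !mulgA -IHn -!mulgA mulVKg.
rewrite /= cword_cons; case: eqP => [xe|xe].
  have xe' : w * u * sigma e = sigma x * (w * u) by rewrite xe mulgVK.
  rewrite (@retr_stay _ _ _ _ x) //; last first.
    by rewrite -mulgA xe' !mulgA -expgS expgSr.
  have -> : sigma x ^+ n * (w * u) = sigma x ^+ n.+1 * (w * (u * sigma e)).
    by rewrite [w * (u * _)]mulgA xe' expgSr -!mulgA cgenK.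
  by rewrite IH // [w * (u * _)]mulgA add1n addSnnS -[a * _ * _]mulgA -expgS -!mulgA.
rewrite retr_move; last first.
  move=> y yX ye; have yx : y = x.
    apply: (h ((w^-1 * sigma x * w) ^+ n * u) e) => //; last by rewrite -posE.
    apply: cox_subM => //; elim: n {posE ye} => [|n IHn]; first exact: cox_sub1.
    by rewrite expgS; apply: cox_subM.
  apply: xe; apply: (mulIg (w * u)); rewrite mulgVK; apply: (mulgI (sigma x ^+ n)).
  by rewrite [RHS]mulgA ye yx mulgA -expgSr expgS !mulgA.
have -> : sigma x ^+ n * (w * u) * sigma e = sigma x ^+ n * (w * (u * sigma e)).
  by rewrite !mulgA.
by rewrite IH // !mulgA.
Qed.

End Braid.

(** Let [z] in [W_B] be equal to [d^-1 x d]. Then [z] crosses no element of [W_B]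
    other than itself: [d] crosses nothing in [d W_B d^-1], and [x] crosses only
    itself. As [z] crosses some generator in [B], it is this generator. *)
Lemma cox_min_rep_sub B w : min_rep w -> exists d u, [/\ w = d * u, cox_sub B u,
   forall x, x \in X -> N u (d^-1 * sigma x * d) = false &
   forall x, x \in X -> cox_sub B (d^-1 * sigma x * d) ->
     exists2 r, r \in B & d^-1 * sigma x * d = sigma r].
Proof.
move=> wmin; have [d [u [wE uB dmin]]] := cox_min_rep B w.
have conjK x : d * (d^-1 * sigma x * d) * d^-1 = sigma x.
  by rewrite -!mulgA mulVKg mulgV mulg1.
exists d, u; split=> // x xX.
  case Nu: (N u _) => //.
  have := wmin x xX; rewrite wE refl_cocycleM Nu addbT => /negbFE.
  by have := dmin _ (cox_sub_cocycle uB Nu); rewrite conjK => ->.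
set z := d^-1 * sigma x * d => zB.
have z1 : z != 1.
  apply/eqP => z1; have := conjK x; rewrite -/z z1 mulg1 mulgV => /esym/eqP.
  by rewrite (negPf (cgen_neq1 _ _)).
have [r rB Nr] := cox_sub_descent zB z1; exists r => //.
have dz : d * z = sigma x * d by rewrite /z !mulgA mulgV mul1g.
have : N (d * z) (d * sigma r * d^-1).
  rewrite refl_cocycleM dmin; last exact: cox_sub_gen.
  by rewrite !mulgA mulVg mul1g mulgVK Nr.
rewrite dz refl_cocycleM refl_cocycle_gen.
have -> : (sigma x)^-1 * (d * sigma r * d^-1) * sigma x = d * (z^-1 * sigma r * z) * d^-1.
  rewrite /z !invgM invgK cgenV !mulgA mulgV mul1g.
  by rewrite -!mulgA mulgV mulg1.
rewrite dmin ?addbF => [/eqP xr|]; first by rewrite /z -xr !mulgA mulVg mul1g mulgVK.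
by apply: cox_subM => //; apply: cox_subM; [exact: cox_subV|exact: cox_sub_gen].
Qed.

(** Write [w = d u] with [u] in the dihedral group of [s], [t] and [d] minimal.
    The only generators in [X] that can occur are [d s d^-1] and [d t d^-1]. If
    both are in [X], then [u = 1], the walk never moves, and the labels form
    another braid relation, since conjugation preserves orders of products. If
    exactly one is in [X], both sides of the relation cross it equally often. If
    none is, the walk is multiplication. *)
Lemma retr_braid s t p : edge s t -> min_rep p.2 ->
  foldl retr_step p (alternating (m s t) s t) = foldl retr_step p (alternating (m s t) t s).
Proof.
case: p => a w st /= wmin; have snt := edge_neq st.
pose B : {pred V} := pred2 s t.
have sB : s \in B by rewrite !inE eqxx.
have tB : t \in B by rewrite !inE eqxx orbT.
have [d [u [wE uB uX dX]]] := cox_min_rep_sub B wmin.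
have altB k : {subset alternate k s t <= B} /\ {subset alternate k t s <= B}.
  by split=> x /alternate_sub; rewrite !inE // orbC.
case: (pselect ((exists2 x, x \in X & d^-1 * sigma x * d = sigma s) /\
                (exists2 y, y \in X & d^-1 * sigma y * d = sigma t))).
  case=> [[x xX xs] [y yX yt]].
  have u1 : u = 1.
    apply/eqP/negPn/negP => /(cox_sub_descent uB)[b].
    by rewrite inE => /orP[] /eqP->; [rewrite -xs|rewrite -yt]; rewrite uX.
  have ws : w * sigma s = sigma x * w by rewrite wE u1 mulg1 -xs !mulgA mulgV mul1g.
  have wt : w * sigma t = sigma y * w by rewrite wE u1 mulg1 -yt !mulgA mulgV mul1g.
  rewrite (walk_stay _ _ xX yX) // (walk_stay _ _ yX xX) //; congr (a * _, w).
  have conj k : (sigma s * sigma t) ^+ k = d^-1 * (sigma x * sigma y) ^+ k * d.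
    rewrite -xs -yt; elim: k => [|k IH]; first by rewrite mulg1 mulVg.
    by rewrite !expgSr IH !mulgA -!(mulgA _ d d^-1) mulgV !mulg1.
  have xy : x != y.
    by apply: contraNneq snt => xy; apply/eqP/(@cgen_inj _ Gamma); rewrite -xs -yt xy.
  (* The labels of [x y] and [s t] agree because each divides the other. *)
  have order k : (sigma x * sigma y) ^+ k = 1 <-> (sigma s * sigma t) ^+ k = 1.
    rewrite conj; split=> [->|e]; first by rewrite mulg1 mulVg.
    apply: (mulgI d^-1); apply: (mulIg d); by rewrite e mulg1 mulVg.
  have xyE : edge x y.
    apply: (@cgen_order_free _ Gamma x y (m s t)) => //; first exact/order/cgen_mul_order.
    exact: leq_trans (label_ge2 st).
  have -> : m s t = m x y.
    apply/eqP; rewrite eqn_dvd; apply/andP; split.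
      exact/(cgen_order_edge snt st)/order/cgen_mul_order.
    exact/(cgen_order_edge xy xyE)/order/cgen_mul_order.
  by apply/pclassP/wcong_rel; exact: ArtinRel.
move=> notboth.
have conjB x : cox_sub B (w^-1 * sigma x * w) -> cox_sub B (d^-1 * sigma x * d).
  move=> xB; have -> : d^-1 * sigma x * d = u * (w^-1 * sigma x * w) * u^-1.
    by rewrite wE invgM !mulgA mulgV mul1g mulgK.
  by apply: cox_subM (cox_subV uB); apply: cox_subM.
have uniqX x y : x \in X -> y \in X -> cox_sub B (w^-1 * sigma x * w) ->
    cox_sub B (w^-1 * sigma y * w) -> y = x.
  move=> xX yX /conjB/(dX _ xX)[r rB xr] /conjB/(dX _ yX)[r' rB' yr'].
  have [rr'|rr'] := eqVneq r r'.
    apply: (@cgen_inj _ Gamma); apply: (mulgI d^-1); apply: (mulIg d).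
    by rewrite xr yr' rr'.
  case: notboth; move: rB rB'; rewrite !inE.
  case/orP=> /eqP rE /orP[] /eqP rE'; rewrite rE rE' ?eqxx // in rr' xr yr'.
    by split; [exists x|exists y].
  by split; [exists y|exists x].
have stayB v e x : cox_sub B v -> e \in B -> w * v * sigma e = sigma x * (w * v) ->
    cox_sub B (w^-1 * sigma x * w).
  move=> vB eB ex; have -> : w^-1 * sigma x * w = v * sigma e * v^-1.
    apply: (mulIg v); apply: (mulgI w); rewrite !mulgA mulgV mul1g mulgVK.
    by rewrite ex mulgA.
  by apply: cox_subM (cox_subV vB); apply: cox_subM => //; apply: cox_sub_gen.
have [altst altts] := altB (m s t).
rewrite !alternating_alternate.
case: (pselect (exists2 x, x \in X & cox_sub B (w^-1 * sigma x * w))).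
  case=> x xX xB; have h v e y : cox_sub B v -> e \in B -> y \in X ->
      w * v * sigma e = sigma y * (w * v) -> y = x.
    by move=> vB eB yX /(stayB _ _ _ vB eB); apply: uniqX.
  have := walk_cross a 0 altst (cox_sub1 _ _) xX xB h.
  have := walk_cross a 0 altts (cox_sub1 _ _) xX xB h.
  by rewrite mulg1 mul1g => -> ->; rewrite crossings_braid // cword_braid.
move=> none.
have h v e x : cox_sub B v -> e \in B -> x \in X ->
    w * v * sigma e <> sigma x * (w * v).
  by move=> vB eB xX /(stayB _ _ _ vB eB) xB; apply: none; exists x.
by rewrite !(@walk_move s t) ?cword_braid.
Qed.

Lemma retr_rel u v p : artin_rel Gamma u v -> min_rep p.2 ->
  foldl retr_step p u = foldl retr_step p v.
Proof. by case=> s t st; apply: retr_braid. Qed.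

Definition retr (p : A * W) (g : A) : A * W := pact retr_step p g.

Let retr_inv (p : A * W) := min_rep p.2.
Let retrK p s b : retr_inv p -> retr_step (retr_step p (s, b)) (s, ~~ b) = p.
Proof. by move=> _; exact: retr_stepK. Qed.

Lemma retr_min p g : min_rep p.2 -> min_rep (retr p g).2.
Proof. exact: (pactP (P := retr_inv) retr_step_min). Qed.

Lemma retrM p g h : min_rep p.2 -> retr p (g * h) = retr (retr p g) h.
Proof. exact: (pactM (P := retr_inv) retr_step_min retrK retr_rel). Qed.

Lemma retr_gen p s : min_rep p.2 -> retr p (agen s) = retr_step p (s, true).
Proof. exact: (pact_gen (P := retr_inv) retr_step_min retrK retr_rel). Qed.

Lemma retr1 p : min_rep p.2 -> retr p 1 = p.
Proof. exact: (pact_class (P := retr_inv) retr_step_min retrK retr_rel [::]). Qed.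

Lemma min_rep1 : min_rep 1.
Proof. by move=> x _; apply: refl_cocycle1. Qed.

End Retraction.

(** * Parabolic subgroups *)

Section Subgroups.
Variable G : groupType.
Implicit Types (H K S : set G) (g h x : G).

Lemma generated_subgroup S : is_subgroup (generated S).
Proof.
split=> [H [[H1 _ _] _] //|a b aS bS H HS|a aS H HS]; case: (HS) => -[H1 HM HV] _.
  by apply: HM; [apply: aS|apply: bS].
by apply: HV; apply: aS.
Qed.

Lemma generated_gen S x : S x -> generated S x.
Proof. by move=> Sx H [_]; apply. Qed.

Lemma generated_ind S H : is_subgroup H -> S `<=` H -> generated S `<=` H.
Proof. exact: smallest_sub. Qed.

Lemma conj_setE g H x : conj_set g H x <-> H (g^-1 * x * g).
Proof.
split=> [[h Hh <-]|Hx]; first by rewrite !mulgA mulVg mul1g mulgVK.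
by exists (g^-1 * x * g); rewrite // -!mulgA mulVKg mulgV mulg1.
Qed.

Lemma conj_setM g h H : conj_set g (conj_set h H) = conj_set (g * h) H.
Proof. by apply/seteqP; split=> x; rewrite !conj_setE invgM !mulgA. Qed.

Lemma conj_set1 H : conj_set 1 H = H.
Proof. by apply/seteqP; split=> x; rewrite conj_setE invg1 mul1g mulg1. Qed.

Lemma conj_setI g H K : conj_set g (H `&` K) = conj_set g H `&` conj_set g K.
Proof. by apply/seteqP; split=> x; rewrite /= !conj_setE. Qed.

Lemma conj_set_subgroup g H : is_subgroup H -> is_subgroup (conj_set g H).
Proof.
case=> H1 HM HV; split=> [|a b|a]; rewrite !conj_setE.
- by rewrite mulg1 mulVg.
- by move=> Ha Hb; have := HM _ _ Ha Hb; rewrite !mulgA mulgK.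
- by move=> /HV; rewrite !invgM invgK mulgA.
Qed.

Lemma conj_set_id g H : is_subgroup H -> H g -> conj_set g H = H.
Proof.
case=> H1 HM HV Hg; apply/seteqP; split=> x; rewrite conj_setE => Hx.
  have -> : x = g * (g^-1 * x * g) * g^-1 by rewrite -!mulgA mulVKg mulgV mulg1.
  by apply: (HM _ _ (HM _ _ Hg Hx)); apply: HV.
exact: HM (HM _ _ (HV _ Hg) Hx) Hg.
Qed.

Lemma conj_generated_sub g S K : is_subgroup K -> (forall s, S s -> K (g * s * g^-1)) ->
  conj_set g (generated S) `<=` K.
Proof.
move=> Ksub SK _ [h hS <-]; move: h hS.
have Ksub' := @conj_set_subgroup g^-1 _ Ksub.
have : generated S `<=` conj_set g^-1 K.
  by apply: generated_ind => // s /SK; rewrite conj_setE invgK.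
by move=> sub h /sub; rewrite conj_setE invgK.
Qed.

End Subgroups.

Section Parabolic.
Variables (V : finType) (Gamma : labeled_graph V).
Local Notation A := (artin_group Gamma).
Local Notation agen := (artin_gen Gamma).
Local Notation par := (@std_parabolic V Gamma).
Local Notation sigma := (cgen Gamma).
Implicit Types (X Y Z : {set V}).

Lemma par_subgroup X : is_subgroup (par X).
Proof. exact: generated_subgroup. Qed.

Lemma par1 X : par X 1. Proof. by case: (par_subgroup X). Qed.

Lemma parM X g h : par X g -> par X h -> par X (g * h).
Proof. by case: (par_subgroup X) => _ + _; apply. Qed.

Lemma parV X g : par X g -> par X g^-1.
Proof. by case: (par_subgroup X) => _ _; apply. Qed.

Lemma par_gen X x : x \in X -> par X (agen x).
Proof. by move=> xX; apply: generated_gen; exists x. Qed.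

Lemma par_ind X H : is_subgroup H -> (forall x, x \in X -> H (agen x)) -> par X `<=` H.
Proof. by move=> Hsub XH; apply: generated_ind => // _ [x xX <-]; apply: XH. Qed.

Lemma par_mono X Y : X \subset Y -> par X `<=` par Y.
Proof.
move=> /fintype.subsetP XY; apply: par_ind; first exact: par_subgroup.
by move=> x /XY; apply: par_gen.
Qed.

Lemma conj_par_sub g X (K : set A) : is_subgroup K ->
  (forall x, x \in X -> K (g * agen x * g^-1)) -> conj_set g (par X) `<=` K.
Proof.
by move=> Ksub XK; apply: conj_generated_sub => // _ [x xX <-]; apply: XK.
Qed.

(** A generator from [X] stays at [w = 1] and is emitted unchanged. *)
Lemma retr_par X g a : par X g -> retr X (a, 1) g = (a * g, 1).
Proof.
move=> gX; move: g gX a.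
apply: (@par_ind X [set g | forall a, retr X (a, 1) g = (a * g, 1)]).
  split=> /= [a|g h gX hX a|g gX a].
  - by rewrite retr1 ?mulg1 //; apply: min_rep1.
  - by rewrite retrM ?gX ?hX ?mulgA //; apply: min_rep1.
  - have := gX (a * g^-1); rewrite mulgVK => {1}<-.
    rewrite -retrM ?mulgV ?retr1 //; exact: min_rep1.
move=> x xX a; rewrite retr_gen; last exact: min_rep1.
by rewrite (@retr_stay _ _ _ _ _ _ _ x) // mulg1 mul1g.
Qed.

Lemma retr_par_fst X g : par X (retr X (1, 1) g).1.
Proof.
suff: forall u p, par X p.1 -> par X (foldl (retr_step X) p u).1.
  by apply; apply: par1.
elim=> [//|[s b] u IH] [a w] aX; apply: IH.
case: (retr_stepP X w s) => [[x xX wx]|h]; last by rewrite retr_move.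
rewrite (retr_stay _ _ xX wx) /=; apply: parM => //.
by case: b; [|apply: parV]; apply: par_gen.
Qed.

(** Act by an element of the intersection on [(1, 1)]. As an element of [A_X] it
    leads to [(g, 1)]. As an element of [A_Y] it keeps [w] in [W_Y], so that
    only generators in both [X] and [Y] are emitted. *)
Lemma par_setI X Y : par X `&` par Y = par (X :&: Y).
Proof.
apply/seteqP; split=> [g [gX gY]|g gXY]; last first.
  by split; apply: par_mono gXY; [exact: finset.subsetIl|exact: finset.subsetIr].
pose Q (p : A * cox_group Gamma) := par (X :&: Y) p.1 /\ cox_sub (mem Y) p.2.
have Qstep p y b : y \in Y -> Q p -> Q (retr_step X p (y, b)).
  case: p => a w yY [/= aXY wY]; case: (retr_stepP X w y) => [[x xX wx]|h]; last first.
    rewrite retr_move //; split=> //=; apply: cox_subM => //.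
    exact: cox_sub_gen.
  rewrite (retr_stay _ _ xX wx); split=> //=.
  have xY : x \in Y.
    apply: (@cox_sub_cgen _ Gamma (mem Y)).
    have -> : sigma x = w * sigma y * w^-1 by rewrite wx mulgK.
    apply: cox_subM; last exact: cox_subV.
    by apply: cox_subM => //; apply: cox_sub_gen.
  have xXY : x \in X :&: Y by rewrite inE xX.
  by apply: parM => //; case: b; [|apply: parV]; apply: par_gen.
have : forall p, min_rep X p.2 -> Q p <-> Q (retr X p g).
  move: g gY {gX}; apply: par_ind => [|y yY p pmin].
    split=> /= [p pmin|g h IHg IHh p pmin|g IHg p pmin].
    - by rewrite retr1.
    - by rewrite retrM // IHg // IHh //; apply: retr_min.
    - by rewrite [X in _ <-> X]IHg; [rewrite -retrM // mulVg retr1|apply: retr_min].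
  rewrite retr_gen //; split=> [|Qp]; first exact: Qstep.
  by rewrite -(retr_stepK X p y true); apply: Qstep.
move=> /(_ (1, 1)) [|+ _]; first exact: min_rep1.
by rewrite (retr_par _ gX) mul1g => -[|//]; split; [apply: par1|apply: cox_sub1].
Qed.

(** Let [g] take [(1, 1)] to [(a, w)]. As [g y g^-1] is in [A_X], the element
    [g y] takes [(1, 1)] to [(g y g^-1 a, w)]. Hence [y] stays at [w] and emits
    a generator [x] with [a x = g y g^-1 a]. *)
Lemma conj_gen_in_par g X Y : (forall y, y \in Y -> par X (g * agen y * g^-1)) ->
  exists a w (f : V -> V), par X a /\ forall y, y \in Y ->
    [/\ f y \in X, g * agen y * g^-1 = a * agen (f y) * a^-1 &
        w * sigma y = sigma (f y) * w].
Proof.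
move=> YX; case E : (retr X (1, 1) g) => [a w]; exists a, w.
have min1 : min_rep X ((1, 1) : A * cox_group Gamma).2 by exact: min_rep1.
have wmin : min_rep X w by have := retr_min g min1; rewrite E.
have ex y : exists x, y \in Y -> [/\ x \in X, g * agen y * g^-1 = a * agen x * a^-1 &
        w * sigma y = sigma x * w].
  case: (boolP (y \in Y)) => yY; last by exists y.
  have : retr X (1, 1) (g * agen y) = retr X (1, 1) ((g * agen y * g^-1) * g).
    by rewrite mulgVK.
  rewrite retrM // [RHS]retrM // (retr_par _ (YX y yY)) E mul1g retr_gen //.
  have -> : retr X (g * agen y * g^-1, 1) g = (g * agen y * g^-1 * a, w).
    have := retr_mull X (g * agen y * g^-1) (1, 1) (repr g).
    rewrite -/(pact _ _ _) -/(retr _ _ _) /= mulg1 => ->.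
    by rewrite -/(pact _ _ _) -/(retr X _ g) E.
  case: (retr_stepP X w y) => [[x xX wx]|h].
    by rewrite (retr_stay _ _ xX wx) => -[ax]; exists x; rewrite ax mulgK.
  rewrite retr_move // => -[_ /eqP]; rewrite -{2}[w]mulg1 (inj_eq (mulgI w)).
  by rewrite (negPf (cgen_neq1 _ _)).
have [f fP] := choice ex; exists f; split=> //.
by have := @retr_par_fst X g; rewrite E.
Qed.

Lemma conj_par_in_par g X Y : conj_set g (par Y) `<=` par X ->
  exists a Z, [/\ par X a, Z \subset X, conj_set g (par Y) = conj_set a (par Z) &
    (free_of_infinity Gamma Z -> free_of_infinity Gamma Y)].
Proof.
move=> YX; have [|a [w [f [aX fP]]]] := @conj_gen_in_par g X Y.
  by move=> y yY; apply: YX; exists (agen y) => //; apply: par_gen.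
exists a, (f @: Y)%SET; split=> //.
- by apply/fintype.subsetP => _ /finset.imsetP[y /fP[fX _ _] ->].
- apply/seteqP; split; apply: conj_par_sub; try exact/conj_set_subgroup/par_subgroup.
    move=> y yY; have [_ -> _] := fP y yY; exists (agen (f y)) => //.
    by apply: par_gen; apply: finset.imset_f.
  move=> _ /finset.imsetP[y yY ->]; have [_ <- _] := fP y yY; exists (agen y) => //.
  exact: par_gen.
(* Both adjacency in the graph and the conjugation by [w] are seen in the
   Coxeter group, where only adjacent generators have a product of finite order. *)
move=> Zfree y z yY zY yz.
have [_ _ wy] := fP y yY; have [_ _ wz] := fP z zY.
have fyE : sigma (f y) = w * sigma y * w^-1 by rewrite wy mulgK.
have fzE : sigma (f z) = w * sigma z * w^-1 by rewrite wz mulgK.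
have fyz : f y != f z.
  apply: contraNneq yz => e; apply/eqP/(@cgen_inj _ Gamma).
  by apply: (mulgI w); apply: (mulIg w^-1); rewrite -fyE -fzE e.
have eE := Zfree _ _ (finset.imset_f f yY) (finset.imset_f f zY) fyz.
apply: (@cgen_order_free _ Gamma y z (label Gamma [set f y; f z]%SET)) => //; last first.
  exact: leq_trans (label_ge2 eE).
have := cgen_mul_order eE; set k := label _ _; rewrite fyE fzE.
have -> : (w * sigma y * w^-1 * (w * sigma z * w^-1)) ^+ k
   = w * (sigma y * sigma z) ^+ k * w^-1.
  elim: k => [|k IH]; first by rewrite mulg1 mulgV.
  by rewrite !expgSr IH -!mulgA !mulKg.
by move=> e; apply: (mulgI w); apply: (mulIg w^-1); rewrite e mulg1 mulgV.
Qed.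

End Parabolic.

(** * Reduced products in a union of two subgroups *)

(** The indicator at the coset [x E0] of the coset [g E0]. *)
Definition coset_mem (G : groupType) (E0 : set G) (g x : G) : bool :=
  `[< E0 (x^-1 * g) >].

(** [H true] and [H false] are the stabilizers of the ends of a base edge whose
    stabilizer is [E0], and [N g] is the mod 2 sum of the edges on a path from
    the vertex [H true] to its translate by [g]. For [g] in [H false] such a
    path consists of the edges [E0] and [g E0]. *)
Section Amalgam.
Variables (G : groupType) (E0 : set G) (H : bool -> set G) (N : G -> G -> bool).
Hypothesis E0_sub : is_subgroup E0.
Hypothesis H_sub : forall i, is_subgroup (H i).
Hypothesis HE0 : forall i g, H i g -> E0 g -> H (~~ i) g.
Hypothesis NM : forall g h x, N (g * h) x = N g x (+) N h (g^-1 * x).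
Hypothesis N_E0 : forall g x, E0 g -> N g x = false.
Hypothesis N_true : forall g x, H true g -> N g x = false.
Hypothesis N_false : forall g x, H false g ->
  N g x = coset_mem E0 1 x (+) coset_mem E0 g x.

Fixpoint reduced (i : bool) (ks : seq G) : Prop :=
  if ks is k :: ks' then [/\ H i k, ~ E0 k & reduced (~~ i) ks'] else True.

Local Notation gprod ks := (\prod_(k <- ks) k).

Let E0V g : E0 g <-> E0 g^-1.
Proof. by case: E0_sub => _ _ EV; split=> [/EV|/EV]; rewrite ?invgK. Qed.

Let E0M g h : E0 g -> E0 h -> E0 (g * h).
Proof. by case: E0_sub => _ + _; apply. Qed.

Let HM i g h : H i g -> H i h -> H i (g * h).
Proof. by case: (H_sub i) => _ + _; apply. Qed.

Let HV i g : H i g -> H i g^-1.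
Proof. by case: (H_sub i) => _ _; apply. Qed.

Lemma reduced_take i j ks : reduced i ks -> reduced i (take j ks).
Proof. by elim: ks i j => [|k ks IH] i [|j] //= [Hk Ek /IH]. Qed.

(** The path of an alternating product only runs through the cosets of its
    prefixes. *)
Lemma N_avoid i ks x : reduced i ks ->
  (forall j, ~ E0 (x^-1 * gprod (take j ks))) -> N (gprod ks) x = false.
Proof.
elim: ks i x => [|k ks IH] i x.
  by move=> _ _; rewrite big_nil; apply: N_E0; case: E0_sub.
case=> Hk Ek kred xks; rewrite big_cons NM.
have -> : N k x = false.
  case: i Hk {kred} => Hk; first exact: N_true.
  have := xks 0%N; have := xks 1%N; rewrite /= take0 big_nil big_seq1 => x1 x0.
  by rewrite N_false // /coset_mem !asboolF.
apply: (IH _ _ kred) => j; have := xks j.+1.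
by rewrite /= big_cons invgM invgK mulgA.
Qed.

(** By induction the cosets of two prefixes at a smaller distance differ. So if
    the product were in [E0], the path would close up and yet traverse the edge
    [k E0] exactly once, against [N_E0]. *)
Lemma reduced_notin i k ks : reduced i (k :: ks) -> ~ E0 (gprod (k :: ks)).
Proof.
have [n] := ubnP (size ks); elim: n => // n IH in i k ks *.
case: ks => [|k' ks]; first by rewrite big_seq1 => _ [].
rewrite ltnS => sz [Hk Ek [Hk' Ek' kred]] Eks.
have := N_E0 k Eks; rewrite !big_cons !NM mulVg mulg1 (N_avoid kred); last first.
  move=> j; rewrite invgK.
  have := IH (~~ i) k' (take j ks) _ _; rewrite big_cons; apply.
    by apply: leq_ltn_trans sz; rewrite size_take_min geq_minr.
  by split=> //; apply: reduced_take.
have E1 : E0 1 by case: E0_sub.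
have Ek1 : ~ E0 k^-1 by move=> /E0V; rewrite invgK.
case: i Hk Hk' {kred} => /= Hk Hk'.
  rewrite (N_true _ Hk) (N_false _ Hk') /coset_mem invg1 !mul1g.
  by rewrite (asboolT E1) (asboolF Ek').
rewrite (N_true _ Hk') (N_false _ Hk) /coset_mem mulg1 mulVg.
by rewrite (asboolT E1) (asboolF Ek1).
Qed.

(** The path runs through the base edge only if it begins with it, that is, if
    the first factor moves the vertex [H true]. *)
Lemma N_reduced i k ks : reduced i (k :: ks) -> N (gprod (k :: ks)) 1 = ~~ i.
Proof.
move=> kks; case: (kks) => Hk Ek kred; rewrite big_cons NM mulg1 (N_avoid kred).
  rewrite addbF; case: i Hk {kks kred} => Hk; first exact: N_true.
  rewrite N_false // /coset_mem invg1 !mul1g (asboolF Ek) asboolT //.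
  by case: E0_sub.
move=> j; rewrite invgK; have := @reduced_notin i k (take j ks).
by rewrite big_cons; apply; apply: (@reduced_take _ j.+1 _ kks).
Qed.

Definition starts_in (i : bool) (g : G) : Prop :=
  exists k ks, reduced i (k :: ks) /\ g = gprod (k :: ks).

Lemma starts_in1 i k : H i k -> ~ E0 k -> starts_in i k.
Proof. by move=> Hk Ek; exists k, [::]; rewrite big_seq1. Qed.

Lemma starts_in_cons i k g : H i k -> ~ E0 k -> starts_in (~~ i) g -> starts_in i (k * g).
Proof.
move=> Hk Ek [k' [ks [kred ->]]]; exists k, (k' :: ks); split=> //.
by rewrite [RHS]big_cons.
Qed.

Lemma starts_in_mulr i j g s : starts_in i g -> H j s ->
  starts_in i (g * s) \/ (E0 (g * s) /\ H i (g * s)).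
Proof.
case=> k [ks [kred ->]] Hs; elim: ks i k kred => [|k' ks IH] i k [Hk Ek kred].
  rewrite big_seq1.
  have small : H i s -> starts_in i (k * s) \/ (E0 (k * s) /\ H i (k * s)).
    move=> Hs'; case: (pselect (E0 (k * s))) => Eks; [right|left].
      by split=> //; apply: HM.
    by apply: starts_in1 => //; apply: HM.
  have [ij|ij] := eqVneq j i; first by apply: small; rewrite -ij.
  have {ij} ij : j = ~~ i by case: (j) (i) ij => [] [].
  case: (pselect (E0 s)) => Es.
    by apply: small; have := HE0 (i := ~~ i) _ Es; rewrite negbK -ij; apply.
  by left; apply: starts_in_cons => //; apply: starts_in1; rewrite -?ij.
rewrite big_cons -mulgA; left; case: (IH _ _ kred) => [|[Eg Hg]].
  exact: starts_in_cons.
have Hg' := HE0 Hg Eg; rewrite negbK in Hg'; apply: starts_in1; first exact: HM.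
move=> Ekg; apply: Ek; rewrite -[k](mulgK (gprod (k' :: ks) * s)).
by apply: E0M => //; apply/E0V; rewrite invgK.
Qed.

Section Orbit.
Variable S : set G.
Hypothesis S_H : forall s, S s -> exists i, H i s.

Lemma generated_starts_in g : generated S g ->
  (E0 g /\ forall i, H i g) \/ exists i, starts_in i g.
Proof.
pose T g := (E0 g /\ forall i, H i g) \/ exists i, starts_in i g.
have EH i h : E0 h -> H i h -> forall j, H j h.
  move=> Eh Hh j; have [<-//|ij] := eqVneq i j.
  have -> : j = ~~ i by case: (i) (j) ij => [] [].
  exact: HE0.
have Tmul h j s : H j s -> T h -> T (h * s).
  move=> Hs [[Eh Hh]|[i /starts_in_mulr/(_ Hs)[hs|[Ehs Hhs]]]].
  - have Hhs : H j (h * s) by apply: HM.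
    case: (pselect (E0 (h * s))) => Ehs; [left|right].
      by split=> //; apply: EH Hhs.
    by exists j; apply: starts_in1.
  - by right; exists i.
  - by left; split=> //; apply: EH Hhs.
have : generated S `<=` [set g | forall h, T h <-> T (h * g)].
  apply: generated_ind.
    split=> /= [h|a b Ta Tb h|a Ta h]; first by rewrite mulg1.
      by rewrite mulgA -Tb -Ta.
    by rewrite [X in _ <-> X]Ta mulgVK.
  move=> s /S_H[j Hs] /= h; split; first exact: Tmul Hs.
  by rewrite -{2}[h](mulgK s); apply: Tmul (HV Hs).
move=> sub /sub /= /(_ 1); rewrite mul1g => -[+ _]; apply; left.
by split=> [|i]; [case: E0_sub|case: (H_sub i)].
Qed.

(** The translates of the base edge by [g M], for [M] generated by [S], form a
    connected subgraph. Hence either one of them is the base edge, or all of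
    them are on the same side of it. *)
Lemma orbit_dichotomy i g : starts_in i g ->
  (exists y, [/\ generated S y, E0 (g * y) & H i (g * y)]) \/
  (forall y, generated S y -> starts_in i (g * y)).
Proof.
move=> gi; case: (pselect (exists y, [/\ generated S y, E0 (g * y) & H i (g * y)])).
  by left.
move=> none; right=> y0.
have [M1 MM MV] := generated_subgroup S.
have step y j s : generated S (y * s) -> H j s ->
    starts_in i (g * y) -> starts_in i (g * (y * s)).
  move=> Sys Hs /starts_in_mulr/(_ Hs); rewrite -mulgA => -[//|[Eg Hg]].
  by case: none; exists (y * s).
have : generated S `<=` [set z | generated S z /\
    forall y, generated S y -> starts_in i (g * y) <-> starts_in i (g * (y * z))].
  apply: generated_ind.
    split=> /= [|a b [Sa Ta] [Sb Tb]|a [Sa Ta]].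
    - by split=> // y _; rewrite mulg1.
    - split=> [|y Sy]; [exact: (MM _ _ Sa Sb)|apply: iff_trans (Ta y Sy) _].
      by rewrite [y * (a * b)]mulgA; exact: (Tb _ (MM _ _ Sy Sa)).
    - split=> [|y Sy]; first exact: (MV _ Sa).
      by rewrite [X in _ <-> X]Ta ?mulgVK //; exact: (MM _ _ Sy (MV _ Sa)).
  move=> s Ss /=; have sS := generated_gen Ss; split=> // y Sy.
  have [j Hs] := S_H Ss; split; first exact: (step y j s (MM _ _ Sy sS) Hs).
  by rewrite -{2}[y](mulgK s); apply: (step (y * s) j s^-1 _ (HV Hs)); rewrite mulgK.
by move=> sub /sub /= [_ /(_ 1 M1)]; rewrite mulg1 mul1g => <-.
Qed.

(** An element [e] of the vertex group on the near side, not fixing the base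
    edge, moves the far side to another branch. It cannot preserve the orbit. *)
Lemma edge_stabilizer i g e y : starts_in i g ->
  (forall z, generated S z -> starts_in i (g * z)) -> generated S y ->
  H (~~ i) e -> e * g = g * y -> E0 e.
Proof.
move=> gi gS Sy He eg; case: (pselect (E0 e)) => // Ee.
have [k [ks [kred egE]]] : starts_in (~~ i) (e * g).
  by apply: starts_in_cons => //; rewrite negbK.
have [k' [ks' [kred' gyE]]] := gS _ Sy.
have := N_reduced kred; rewrite -egE eg gyE (N_reduced kred').
by case: (i).
Qed.

End Orbit.
End Amalgam.

(** * The splitting over two non-adjacent vertices *)

Section Splitting.
Variables (V : finType) (Gamma : labeled_graph V) (v w : V).
Hypothesis vw : v != w.
Hypothesis vwE : [set v; w]%SET \notin edges Gamma.
Local Notation A := (artin_group Gamma).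
Local Notation agen := (artin_gen Gamma).
Local Notation par := (@std_parabolic V Gamma).

Let E0 : set A := par ([set: V] :\ v :\ w)%SET.
Let letter (a : V * bool) : A := if a.2 then agen a.1 else (agen a.1)^-1.

Let edge_at (g x : A) : bool := coset_mem E0 g x.

(** Among the generators only [v] moves the base vertex, whose stabilizer is
    generated by the others; it contributes the edges [E0] and [v E0]. *)
Definition split_step (p : A * bool) (a : V * bool) : A * bool :=
  ((letter a)^-1 * p.1,
   p.2 (+) (if a.1 == v then edge_at 1 p.1 (+) edge_at (letter a) p.1 else false)).

Let edge_atM g h x : edge_at (g * h) x = edge_at h (g^-1 * x).
Proof. by rewrite /edge_at /coset_mem invgM invgK mulgA. Qed.

Let edge_atE0 g h x : E0 h -> edge_at (g * h) x = edge_at g x.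
Proof.
move=> Eh; rewrite /edge_at /coset_mem; apply/asboolP/asboolP; rewrite mulgA.
  by move=> /parM/(_ (parV Eh)); rewrite mulgK.
by move=> /parM; apply.
Qed.

Let letterE a : pclass (artin_rel Gamma) [:: a] = letter a.
Proof. by case: a => s [] //; rewrite /letter /= -pclassV. Qed.

Let letterV s b : letter (s, ~~ b) = (letter (s, b))^-1.
Proof. by case: b; rewrite /letter /= ?invgK. Qed.

Let foldl_split_noV u p : all (fun a => a.1 != v) u ->
  foldl split_step p u = ((pclass (artin_rel Gamma) u)^-1 * p.1, p.2).
Proof.
elim: u p => [|a u IH] [x e] /=; first by rewrite invg1 mul1g.
move=> /andP[av uv]; rewrite IH //= (negPf av) addbF -cat1s pclassM letterE.
by rewrite invgM mulgA.
Qed.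

Let foldl_split_noW u x e g : all (fun a => a.1 != w) u ->
  foldl split_step (g^-1 * x, e (+) edge_at g x) u =
  ((g * pclass (artin_rel Gamma) u)^-1 * x,
    e (+) edge_at (g * pclass (artin_rel Gamma) u) x).
Proof.
elim: u g => [|a u IH] g /=; first by rewrite !mulg1.
move=> /andP[aw uw]; rewrite -cat1s pclassM letterE mulgA -IH //.
congr foldl; rewrite /split_step /= -!edge_atM mulg1 !invgM !mulgA; congr (_, _).
case: eqVneq => [_|av]; first by rewrite -addbA [X in _ (+) X]addbA addbb.
rewrite addbF edge_atE0 // /letter.
have aE : a.1 \in [set: V] :\ v :\ w by rewrite !inE aw av.
by case: a.2; [|apply: parV]; apply: par_gen.
Qed.

Let split_stepK p s b : split_step (split_step p (s, b)) (s, ~~ b) = p.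
Proof.
case: p => x e; rewrite /split_step /= letterV invgK mulVKg.
case: eqP => _; last by rewrite !addbF.
by rewrite -!edge_atM mulg1 mulgV [X in _ (+) X]addbC addbK.
Qed.

(** The letters of a relation avoid [v] or avoid [w]. In the first case both
    sides contribute nothing; in the second, the contribution is a coboundary
    and only depends on the element of the group. *)
Lemma split_rel u u' p : artin_rel Gamma u u' ->
  foldl split_step p u = foldl split_step p u'.
Proof.
move=> uu'; have /pclassP uuE : wcong (artin_rel Gamma) u u' by apply: wcong_rel.
have : exists2 z, z = v \/ z = w & all (fun a => a.1 != z) u && all (fun a => a.1 != z) u'.
  case: uu' {uuE} => s t stE.
  have [z zvw /andP[sz tz]] : exists2 z, z = v \/ z = w & (s != z) && (t != z).
    have st := edge_neq stE.
    case: (boolP ((s != v) && (t != v))) => [h|hv]; first by exists v; [left|].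
    case: (boolP ((s != w) && (t != w))) => [h|hw]; first by exists w; [right|].
    move: hv hw st vw vwE stE; rewrite !negb_and !negbK.
    case/orP=> /eqP-> /orP[] /eqP->; rewrite ?eqxx //.
      by move=> _ _ /negP h /h.
    by move=> _ _; rewrite finset.setUC => /negP h /h.
  exists z => //; have avoid k : all (fun a => a.1 != z) (alternating k s t) /\
      all (fun a => a.1 != z) (alternating k t s).
    by elim: k => //= k [-> ->]; rewrite sz tz.
  by have [-> ->] := avoid (label Gamma [set s; t]%SET).
case=> z [] -> /andP[hu hu']; first by rewrite !foldl_split_noV // uuE.
case: p => x e; have -> : (x, e) = (1^-1 * x, (e (+) edge_at 1 x) (+) edge_at 1 x).
  by rewrite invg1 mul1g -addbA addbb addbF.
by rewrite !foldl_split_noW // uuE.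
Qed.

Lemma split_cocycle : exists N : A -> A -> bool,
  [/\ forall g h x, N (g * h) x = N g x (+) N h (g^-1 * x),
      forall g x, par ([set: V] :\ v)%SET g -> N g x = false &
      forall g x, par ([set: V] :\ w)%SET g ->
        N g x = coset_mem E0 1 x (+) coset_mem E0 g x].
Proof.
pose act p g := pact (R := artin_rel Gamma) split_step p g.
pose T (p : A * bool) := True.
have stepP p a : T p -> T (split_step p a) by [].
have stepK p s b : T p -> split_step (split_step p (s, b)) (s, ~~ b) = p.
  by rewrite split_stepK.
have stepR u u' p : artin_rel Gamma u u' -> T p ->
    foldl split_step p u = foldl split_step p u'.
  by move=> uu' _; apply: split_rel.
have actM p g h : act p (g * h) = act (act p g) h.
  exact: (pactM stepP stepK stepR g h I).
have act_gen p s : act p (agen s) = split_step p (s, true).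
  exact: (pact_gen stepP stepK stepR s I).
have act1 p : act p 1 = p.
  exact: (pact_class stepP stepK stepR [::] I).
have actE g x e : act (x, e) g = (g^-1 * x, e (+) (act (x, false) g).2).
  suff: forall u x e, foldl split_step (x, e) u =
     ((pclass (artin_rel Gamma) u)^-1 * x, e (+) (foldl split_step (x, false) u).2).
    by move=> /(_ (repr g)); rewrite pclass_repr; apply.
  elim=> [|a u IH] {}x {}e /=; first by rewrite invg1 mul1g addbF.
  rewrite IH [in RHS]IH -[a :: u]cat1s pclassM letterE invgM -mulgA /=.
  by rewrite addbA.
pose N g x := (act (x, false) g).2.
have NM g h x : N (g * h) x = N g x (+) N h (g^-1 * x).
  rewrite /N actM; have := actE g x false.
  by case: (act (x, false) g) => [y e] /= [->]; rewrite (actE h _ e).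
have N1 x : N 1 x = false by rewrite /N act1.
have NV g x : N g^-1 x = N g (g * x).
  have := NM g g^-1 (g * x); rewrite mulgV N1 mulKg.
  by case: (N g _); case: (N _ _).
exists N; split=> // g x.
  move=> gv; move: g gv x; apply: par_ind => [|s sv x].
    split=> [x|a b Na Nb x|a Na x] //; first by rewrite NM Na Nb.
    by rewrite NV Na.
  by move: sv; rewrite /N act_gen !inE /= => /andP[/negPf->].
move=> gw; move: g gw x; apply: par_ind => [|s sw x].
  split=> [x|a b Na Nb x|a Na x]; first by rewrite N1 addbb.
    rewrite NM Na Nb -!/(edge_at _ _) -!edge_atM mulg1.
    by rewrite -addbA [X in _ (+) X]addbA addbb.
  by rewrite NV Na -!/(edge_at _ _) -[in edge_at 1 (a * x)](invgK a) -edge_atM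
    -[in edge_at a (a * x)](invgK a) -edge_atM mulg1 invgK mulVg addbC.
have := @foldl_split_noW [:: (s, true)] x (edge_at 1 x) 1.
rewrite /= andbT => /(_ _)/(congr1 snd)/=; rewrite invg1 !mul1g addbb letterE => <-.
  by rewrite /N act_gen.
by move: sw; rewrite !inE => /andP[].
Qed.

End Splitting.

(** * Intersections of parabolic subgroups *)

Section Main.
Variables (V : finType) (Gamma : labeled_graph V).
Local Notation A := (artin_group Gamma).
Local Notation agen := (artin_gen Gamma).
Local Notation par := (@std_parabolic V Gamma).
Local Notation free := (@free_of_infinity V Gamma).
Local Notation parabolic := (@parabolic V Gamma).
Implicit Types (X Y Z U : {set V}) (g h k : A).

Lemma parabolic_conj g P : parabolic P -> parabolic (conj_set g P).
Proof. by case=> h [X ->]; exists (g * h), X; rewrite conj_setM. Qed.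

(** The intersections are required to be parabolic in the whole group;
    [conj_par_in_par] then locates them inside smaller parabolic subgroups. *)
Definition meets_parabolically U := forall X Y g, free X -> X \subset U -> Y \subset U ->
  par U g -> parabolic (par X `&` conj_set g (par Y)).

Section Step.
Variables (U : {set V}) (v w : V).
Hypothesis vw : v != w.
Hypothesis vwE : [set v; w]%SET \notin edges Gamma.

Let half (i : bool) : {set V} := if i then (U :\ v)%SET else (U :\ w)%SET.
Let core : {set V} := (U :\ v :\ w)%SET.
Hypothesis IH : forall i, meets_parabolically (half i).

Let core_half i : core \subset half i.
Proof.
by case: i; apply/fintype.subsetP => x; rewrite !inE => /and3P[xw xv xU]; apply/andP.
Qed.

Let E0 : set A := par ([set: V] :\ v :\ w)%SET.

Let half_E0 i g : par (half i) g -> E0 g -> par core g.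
Proof.
move=> hg Eg; have : (par (half i) `&` E0) g by split.
rewrite par_setI; apply: par_mono; apply/fintype.subsetP => x.
rewrite /half /core; case: i {hg}; rewrite !inE.
  by move=> /andP[/andP[-> ->] /and3P[-> _ _]].
by move=> /andP[/andP[-> ->] /and3P[_ -> _]].
Qed.

Lemma free_half X : free X -> X \subset U -> exists i, X \subset half i.
Proof.
move=> Xfree XU; case: (boolP (v \in X)) => vX; last first.
  by exists true; rewrite subsetD1 XU.
exists false; rewrite subsetD1 XU /=; apply/negP => wX.
by move: vwE; rewrite Xfree.
Qed.

(** [A_X] and [k] lie in the parabolic subgroup on [half i], so only the
    part of [A_Y] in this subgroup counts. *)
Lemma meet_base i X Y k : free X -> X \subset half i -> Y \subset U -> par (half i) k ->
  parabolic (par X `&` conj_set k (par Y)).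
Proof.
move=> Xfree Xi YU ki.
have -> : par X `&` conj_set k (par Y) = par X `&` conj_set k (par (half i :&: Y)).
  apply/seteqP; split=> z /= [zX]; rewrite -par_setI conj_setI.
    move=> zY; split=> //; split=> //.
    by rewrite conj_set_id //; [apply: par_mono zX|apply: par_subgroup].
  by case.
by apply: IH ki => //; apply: finset.subsetIl.
Qed.

Lemma meets_parabolically_split : meets_parabolically U.
Proof.
have [N [NM Nv Nw]] := split_cocycle vw vwE.
pose H i := par (half i).
have E0_sub : is_subgroup E0 by exact: par_subgroup.
have H_sub i : is_subgroup (H i) by exact: par_subgroup.
have HE i j g : H i g -> E0 g -> H j g.
  by move=> Hg Eg; apply: par_mono (half_E0 Hg Eg); apply: core_half.
have HE0 i g := HE i (~~ i) g.
have half_top i : half i \subset ([set: V] :\ (if i then v else w))%SET.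
  by case: i; apply: finset.setSD; apply: finset.subsetT.
have N_E0 g x : E0 g -> N g x = false.
  by move=> Eg; apply: Nv; apply: par_mono Eg; apply: subD1set.
have N_true g x : H true g -> N g x = false.
  by move=> Hg; apply: Nv; apply: par_mono Hg; apply: (half_top true).
have N_false g x : H false g -> N g x = coset_mem E0 1 x (+) coset_mem E0 g x.
  by move=> Hg; apply: Nw; apply: par_mono Hg; apply: (half_top false).
have gens_half Y s : Y \subset U -> [set agen y | y in [set` Y]] s -> exists i, H i s.
  move=> YU [y yY <-]; have yU := fintype.subsetP YU _ yY.
  have [yv|yv] := eqVneq y v; [exists false|exists true];
    apply: par_gen; rewrite !inE yU andbT //.
  by rewrite yv.
(* One step from the vertex fixed by [A_X] towards the subtree of
   [h g A_Y (h g)^-1], along the edge with stabilizer [h A_core h^-1]. *)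
have reduce Y i g X h : Y \subset U -> starts_in E0 H i g ->
    free X -> X \subset half (~~ i) -> par (half (~~ i)) h ->
    (forall Z b, free Z -> Z \subset core -> par core b ->
       parabolic (par Z `&` conj_set (b^-1 * g) (par Y))) ->
    parabolic (par X `&` conj_set (h * g) (par Y)).
  move=> YU gi Xfree Xi hi next.
  have YH s : [set agen y | y in [set` Y]] s -> exists i, H i s by exact: gens_half.
  case: (orbit_dichotomy E0_sub H_sub HE0 YH gi) => [[y [yY Egy Hgy]]|gY].
    have <- : conj_set (h * (g * y)) (par Y) = conj_set (h * g) (par Y).
      by rewrite mulgA -[LHS]conj_setM (conj_set_id (@par_subgroup _ _ Y) yY).
    by apply: meet_base Xi YU _ => //; apply: parM => //; apply: HE Hgy Egy.
  (* The subgroup of [A_X] fixing this edge is again a conjugate of a standard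
     parabolic subgroup [A_Z] inside the edge group, with [Z] free of infinity. *)
  have [c [Z0 IE]] : parabolic (par X `&` conj_set h (par core)).
    exact: IH (core_half _) hi.
  have sub_core : conj_set (h^-1 * c) (par Z0) `<=` par core.
    rewrite -conj_setM -IE conj_setI conj_setM mulVg conj_set1.
    by apply: subIset; right.
  have [b [Z [bC ZC ZE _]]] := conj_par_in_par sub_core.
  have {}IE : par X `&` conj_set h (par core) = conj_set (h * b) (par Z).
    by rewrite -conj_setM -ZE conj_setM mulVKg.
  have ZX : conj_set (h * b) (par Z) `<=` par X by rewrite -IE; apply: subIset; left.
  have [a [Z' [_ Z'X _ Z'free]]] := conj_par_in_par ZX.
  have Zfree : free Z.
    by apply: Z'free => s t sZ tZ; apply: Xfree; apply: (fintype.subsetP Z'X).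
  have -> : par X `&` conj_set (h * g) (par Y) =
      conj_set (h * b) (par Z `&` conj_set (b^-1 * g) (par Y)).
    rewrite conj_setI conj_setM -IE -[h * b * _]mulgA mulVKg.
    apply/seteqP; split=> z /= [zX zY]; split=> //; last by case: zX.
    split=> //; rewrite conj_setE; move: (zY); rewrite conj_setE => yY.
    have eH : H (~~ i) (h^-1 * z * h).
      apply: parM => //; apply: parM; first exact: parV.
      exact: par_mono zX.
    apply: (half_E0 eH).
    apply: (edge_stabilizer E0_sub NM N_E0 N_true N_false gi gY yY eH).
    by rewrite invgM !mulgA mulgV mul1g.
  by apply: parabolic_conj; apply: next.
have main Y i ks k : Y \subset U -> reduced E0 H i (k :: ks) ->
    forall X h, free X -> X \subset half (~~ i) -> par (half (~~ i)) h ->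
    parabolic (par X `&` conj_set (h * \prod_(k <- k :: ks) k) (par Y)).
  move=> YU; elim: ks i k => [|k' ks IHks] i k kred X h Xfree Xi hi.
    apply: reduce hi _ => //; first by exists k, [::].
    move=> Z b Zfree ZC bC; rewrite big_seq1; apply: (@meet_base i) => //.
      exact: fintype.subset_trans (core_half i).
    by case: kred => Hk _ _; apply: parM => //; apply: parV; apply: par_mono bC.
  apply: reduce hi _ => //; first by exists k, (k' :: ks).
  move=> Z b Zfree ZC bC; rewrite big_cons mulgA; case: kred => Hk _ kred.
  have := IHks _ _ kred Z (b^-1 * k) Zfree; rewrite negbK; apply.
    exact: fintype.subset_trans (core_half i).
  by apply: parM => //; apply: parV; apply: par_mono bC.
move=> X Y g Xfree XU YU gU; have [j Xj] := free_half Xfree XU.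
have UH s : [set agen y | y in [set` U]] s -> exists i, H i s by exact: gens_half.
case: (generated_starts_in E0_sub H_sub HE0 UH gU) => [[_ Hg]|[i [k [ks [kred gE]]]]].
  exact: meet_base Xj YU (Hg j).
have [ij|ij] := eqVneq i (~~ j).
  rewrite gE -[\prod_(_ <- _) _]mul1g; apply: (main _ _ _ _ YU kred) => //.
    by rewrite ij negbK.
  exact: par1.
have {ij} ij : i = j by case: (i) (j) ij => [] [].
case: ks kred gE => [|k' ks] kred ->.
  by rewrite big_seq1; apply: meet_base Xj YU _; case: kred => + _ _; rewrite ij.
rewrite big_cons; case: kred => Hk _ kred.
by apply: (main _ _ _ _ YU kred) => //; rewrite negbK ij // -ij.
Qed.

End Step.

Lemma all_meet_parabolically U : property_Int Gamma -> meets_parabolically U.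
Proof.
move=> Int; have [n] := ubnP #|U|; elim: n => // n IH in U *.
rewrite ltnS => Un; case: (pselect (free U)) => [Ufree X Y g Xfree XU YU gU|Unfree].
  have XP : parabolic_in U (par X).
    by exists 1, X; rewrite conj_set1; split=> //; apply: par1.
  have YP : parabolic_in U (conj_set g (par Y)) by exists g, Y.
  by have [h [Z [_ _ ZE]]] := Int U Ufree _ _ XP YP; exists h, Z.
have [v [w [vU wU vw vwE]]] : exists v w, [/\ v \in U, w \in U, v != w &
    [set v; w]%SET \notin edges Gamma].
  apply: contrapT => none; apply: Unfree => v w vU wU vw.
  by apply/negPn/negP => vwE; apply: none; exists v, w.
refine (meets_parabolically_split vw vwE _) => i.
refine (IH _ _); apply: leq_trans Un.
by case: i; [rewrite [#|U|](cardsD1 v) vU|rewrite [#|U|](cardsD1 w) wU].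
Qed.

Lemma par_setT g : par [set: V]%SET g.
Proof.
rewrite -(pclass_repr g) -weval_pgen; elim: (repr g) => [|[s b] u IH] /=; first exact: par1.
apply: parM IH; case: b => /=; [|apply: parV]; by apply: par_gen; rewrite finset.in_setT.
Qed.

End Main.

Theorem theorem1p1 (V : finType) (Gamma : labeled_graph V) (V_nonempty : 0 < #|V|) :
  property_Int Gamma -> property_Int_plus_minus_minus Gamma.
Proof.
move=> Int _ _ [g [X [Xfree ->]]] [h [Y ->]].
have -> : conj_set g (@std_parabolic V Gamma X) `&` conj_set h (@std_parabolic V Gamma Y) =
  conj_set g (@std_parabolic V Gamma X `&` conj_set (g^-1 * h) (@std_parabolic V Gamma Y)).
  by rewrite conj_setI conj_setM mulVKg.
apply: parabolic_conj.
apply: (all_meet_parabolically Int Xfree); try exact: finset.subsetT.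
exact: par_setT.
Qed.
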